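(* Let $n\ge5$ and let $P^n_\omega$ be a non-trivially weighted edge-weighted path with vertices $x_1,\dots,x_n$, edges $e_i=\{x_i,x_{i+1}\}$ and weights $\omega_i=\omega(e_i)$, whose edge ideal $I=I(P^n_\omega)\subseteq S=\mathbb{K}[x_1,\dots,x_n]$ is integrally closed. If $\omega_1=\max\{\omega_i\mid i\in[n-1]\}$, then for all $t\ge1$, $$\operatorname{reg}(S/I^t)\le 2(t-1)\omega_1+\operatorname{reg}(S/I).$$
   Context: $\mathbb{K}$ is a field. For a simple graph $G$ with weight function $\omega:E(G)\to\mathbb{Z}_{>0}$, $I(G_\omega)=(x_i^{\omega(e)}x_j^{\omega(e)}\mid e=\{x_i,x_j\}\in E(G))$. An edge has non-trivial weight if its weight is $\ge2$; the path is non-trivially weighted if some edge does. An ideal is integrally closed if it equals its integral closure. *)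

(* Defs.v *)
From HB Require Import structures.
From mathcomp Require Import all_boot all_order all_algebra.
From mathcomp Require Import mpoly.
From Stdlib Require Import ClassicalEpsilon.
Set Implicit Arguments. Unset Strict Implicit. Unset Printing Implicit Defensive.
Import Order.TTheory GRing.Theory.
Local Open Scope ring_scope.

Section Defs.
Variables (K : fieldType) (n : nat).
Local Notation S := {mpoly K[n]}.

Definition in_ideal (gs : seq S) (f : S) : Prop :=
  exists cs : seq S, size cs = size gs /\
    f = \sum_(i < size gs) cs`_i * gs`_i.

Fixpoint pow_gens (gs : seq S) (t : nat) : seq S :=
  if t is t'.+1 then [seq g * h | g <- gs, h <- pow_gens gs t'] else [:: 1].

Definition integral_over (gs : seq S) (f : S) : Prop :=
  exists (k : nat) (a : nat -> S), (0 < k)%N /\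
    (forall i, (1 <= i <= k)%N -> in_ideal (pow_gens gs i) (a i)) /\
    f ^+ k + \sum_(1 <= i < k.+1) a i * f ^+ (k - i) = 0.

Definition integrally_closed (gs : seq S) : Prop :=
  forall f : S, integral_over gs f <-> in_ideal gs f.

(* ---- Graded Betti numbers of S/I for a monomial ideal I = (gs) ----
   beta_{i,b}(S/I) = dim_K Tor_i^S(K, S/I)_b, computed as the homology
   in multidegree b of the Koszul complex K(x_1..x_n ; S/I).
   Since I is a monomial ideal, (S/I)_c is K.x^c if x^c \notin I and 0
   otherwise; the chain group in homological degree i and multidegree b
   has basis e_F (x) x^(b - F), F subset of [n], #|F| = i, F <= b,
   x^(b-F) \notin I. *)

Definition monomial_gens (gs : seq S) : Prop :=
  forall g, g \in gs -> exists m : 'X_{1..n}, g = 'X_[m].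

Definition mon_in (gs : seq S) (m : 'X_{1..n}) : bool :=
  if excluded_middle_informative (in_ideal gs 'X_[m]) then true else false.

Definition msubset (b : 'X_{1..n}) (F : {set 'I_n}) : 'X_{1..n} :=
  [multinom (b i - (i \in F))%N | i < n].

Definition kvalid (gs : seq S) (b : 'X_{1..n}) (F : {set 'I_n}) : bool :=
  [forall j in F, (0 < b j)%N] && ~~ mon_in gs (msubset b F).

(* Koszul differential d_i : C_i -> C_{i-1} in multidegree b, as a matrix
   indexed by all subsets of 'I_n (row = source e_F, column = target e_G),
   with zero rows/columns outside the relevant bases. *)
Definition koszul_mx (gs : seq S) (b : 'X_{1..n}) (i : nat)
  : 'M[K]_(#|{: {set 'I_n}}|, #|{: {set 'I_n}}|) :=
  \matrix_(r < #|{: {set 'I_n}}|, c < #|{: {set 'I_n}}|)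
    let F := (enum_val r : {set 'I_n}) in
    let G := (enum_val c : {set 'I_n}) in
    if [&& kvalid gs b F, #|F| == i, kvalid gs b G, G \subset F
         & #|F :\: G| == 1%N]
    then (-1) ^+ #|[set k in G | [exists j in F :\: G, (k < j)%N]]|
    else 0.

Definition kchain_dim (gs : seq S) (b : 'X_{1..n}) (i : nat) : nat :=
  #|[set F : {set 'I_n} | kvalid gs b F && (#|F| == i)]|.

(* beta_{i,b}(S/I) = dim ker d_i - dim im d_{i+1} *)
Definition betti (gs : seq S) (i : nat) (b : 'X_{1..n}) : nat :=
  (kchain_dim gs b i - \rank (koszul_mx gs b i)
     - \rank (koszul_mx gs b i.+1))%N.

Definition is_reg (gs : seq S) (r : nat) : Prop :=
  (forall i b, betti gs i b <> 0%N -> (mdeg b <= i + r)%N) /\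
  (exists i b, betti gs i b <> 0%N /\ mdeg b = (i + r)%N).

Definition reg_le (gs : seq S) (r : nat) : Prop :=
  forall i b, betti gs i b <> 0%N -> (mdeg b <= i + r)%N.

(* Edge ideal of the weighted path P^n_w: vertices x_1..x_n are 'X_0..'X_(n-1),
   edge e_(i+1) = {x_(i+1), x_(i+2)} has weight w i, for i < n-1. *)
Definition path_gens (w : nat -> nat) : seq S :=
  [seq ('X_i * 'X_j) ^+ w i
     | i <- enum 'I_n, j <- [seq j <- enum 'I_n | val j == (val i).+1]].

End Defs.

(* Main.v *)
Require Import Defs.
From HB Require Import structures.
From mathcomp Require Import all_boot all_order all_algebra.
From mathcomp Require Import mpoly.
From mathcomp Require Import zify ring.
From Stdlib Require Import Classical ClassicalEpsilon.
Set Implicit Arguments. Unset Strict Implicit. Unset Printing Implicit Defensive.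
Import GRing.Theory.
Local Open Scope ring_scope.

(* Number vertices and edges from 0, let a = w 0 and nu = (n - 2) %/ 3, the
   regularity of the unweighted path on x_3, .., x_(n-1).  If I is integrally
   closed and a >= 2, every edge other than e_0 and e_2 has weight 1.  The
   induced matching e_0, e_3, e_6, .. then gives reg (S/I) >= 2 a - 1 + nu, and
   it suffices to show reg (S/I^t) <= 2 a t - 1 + nu.

   For this, split off edges from the right by means of
     reg (S/J) <= max (reg (S/(J : m)) + deg m, reg (S/(J + m))),
   staying within the family V + (e_j, e_(j+1), ..) + (e_0, .., e_(j-1))^q with
   V a set of variables.  When e_2 has weight >= 2, one stops at j = 3 and
   splits off e_1: the colon by e_1 again lowers q by one, because
   e_0 e_2 / (x_1 x_2) is a multiple of e_1, and adding e_1 leaves only the pure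
   powers e_0^q and e_2^q.  The remaining ideals are unweighted paths with one
   or two pure powers added, which raise the regularity in a controlled way. *)

(** * Exactness of Koszul complexes over families of sets *)

Section Chains.
Variables (K : fieldType) (n : nat).
Implicit Types (F G H : {set 'I_n}) (z y : {set 'I_n} -> K).
Implicit Types (X A B : {set 'I_n} -> Prop).

Definition sgn G (j : 'I_n) : K := (-1) ^+ #|[set k in G | (k < j)%N]|.

(** The coefficient at [G] of the Koszul differential of the sum of the [z F] e_F. Chains are
    functions on all subsets, so no basis has to be carried along. *)
Definition bd z G : K := \sum_(j | j \notin G) sgn G j * z (j |: G).

Definition chain X i z := forall F, z F != 0 -> X F /\ #|F| = i.

(** Vanishing of the i-th homology of the complex spanned by the e_F with [X F], the differential
    being truncated to [X]. *)
Definition exact X i := forall z, chain X i z ->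
  (forall G, X G -> bd z G = 0) ->
  exists2 y, chain X i.+1 y & forall G, X G -> bd y G = z G.

(** This is what makes the truncated differential square to zero. *)
Definition convex X := forall F G H, X F -> X H ->
  F \subset G -> G \subset H -> X G.

Definition cut X z F : K :=
  if excluded_middle_informative (X F) then z F else 0.

Lemma cutT X z F : X F -> cut X z F = z F.
Proof. by rewrite /cut; case: excluded_middle_informative. Qed.

Lemma chain0 X i z F : chain X i z -> ~ X F -> z F = 0.
Proof. by move=> cz nXF; case: eqVneq (cz F) => // _ /(_ isT) []. Qed.

Lemma cut_chain X i z F : chain X i z -> cut X z F = z F.
Proof.
move=> cz; rewrite /cut; case: excluded_middle_informative => // nXF.
by rewrite (chain0 cz nXF).
Qed.

Lemma sgnU G j k : j \notin G ->
  sgn (j |: G) k = (-1) ^+ (j < k)%N * sgn G k.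
Proof.
move=> jG; rewrite /sgn -exprD; congr (_ ^+ _).
case: ltnP => jk.
  rewrite (_ : [set _ in _ | _] = j |: [set i in G | (i < k)%N]).
    by rewrite cardsU1 inE (negPf jG).
  by apply/setP=> i; rewrite !inE; case: eqVneq => [->|].
rewrite add0n; apply: eq_card => i; rewrite !inE.
by case: eqVneq => [->|]//=; rewrite (negPf jG) ltnNge jk.
Qed.

Lemma sgn_sq G j : sgn G j * sgn G j = 1.
Proof. by rewrite -expr2 sqrr_sign. Qed.

Lemma eq_bd z y G : (forall j, j \notin G -> z (j |: G) = y (j |: G)) ->
  bd z G = bd y G.
Proof. by move=> E; apply: eq_bigr => j jG; rewrite E. Qed.

Lemma bd0 z G : (forall j, j \notin G -> z (j |: G) = 0) -> bd z G = 0.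
Proof. by move=> E; apply: big1 => j jG; rewrite E// mulr0. Qed.

Lemma bdD z y G : bd (fun F => z F + y F) G = bd z G + bd y G.
Proof. by rewrite -big_split; apply: eq_bigr => j _; rewrite mulrDr. Qed.

Lemma bdB z y G : bd (fun F => z F - y F) G = bd z G - bd y G.
Proof. by rewrite -sumrB; apply: eq_bigr => j _; rewrite mulrBr. Qed.

(** The terms of the pairs (j, k) and (k, j) cancel: an inserted index changes the sign of the other
    one only if it is the smaller of the two. *)
Lemma bd_bd z G : bd (bd z) G = 0.
Proof.
rewrite /bd; under eq_bigr do rewrite mulr_sumr.
rewrite pair_big_dep /= (bigID (fun p : 'I_n * 'I_n => (p.1 < p.2)%N)) /=.
rewrite [X in _ + X](reindex_inj (h := fun p : 'I_n * 'I_n => (p.2, p.1))) /=;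
  last by move=> [? ?] [? ?] [-> ->].
rewrite [X in _ + X](eq_bigl
  (fun p : 'I_n * 'I_n => (p.1 \notin G) && (p.2 \notin p.1 |: G) && (p.1 < p.2)%N)); last first.
  case=> j k /=; rewrite !inE !negb_or; case: (ltngtP j k) => [jk|jk|/ord_inj->];
    rewrite ?andbF ?eqxx ?andbF//= ?andbT.
  have -> : (k == j) = false by apply/negbTE; rewrite neq_ltn jk orbT.
  have -> : (j == k) = false by apply/negbTE; rewrite neq_ltn jk.
  by rewrite andbC.
rewrite -big_split /= big1// => -[j k] /= /andP[/andP[jG]].
rewrite !inE negb_or => /andP[_ kG] jk.
rewrite !sgnU// jk (ltnNge k) (ltnW jk) /= setUCA; ring.
Qed.

Lemma chain_bd_card X i z G : chain X i.+1 z -> bd z G != 0 -> #|G| = i.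
Proof.
move=> cz; case: (eqVneq #|G| i) => // nG; rewrite bd0 ?eqxx// => j jG.
apply/eqP; apply: contraT => /cz[_]; rewrite cardsU1 jG => -[/eqP].
by rewrite (negPf nG).
Qed.

Lemma bd_cut X i z G : convex X -> chain X i z -> X G ->
  bd (cut X (bd z)) G = 0.
Proof.
move=> cX cz XG; rewrite -[RHS](bd_bd z G); apply: eq_bd => j jG.
rewrite /cut; case: excluded_middle_informative => // nX.
rewrite bd0// => k kjG; apply: (chain0 cz) => XH; apply: nX.
by apply: (cX G _ _ XG XH); apply: subsetUr.
Qed.

(** * Homology of a subcomplex and of its quotient *)

Section Split.
Variables (X P : {set 'I_n} -> Prop).
Hypothesis cX : convex X.
Hypothesis dP : forall F G, X F -> X G -> G \subset F -> P F -> P G.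
Let A F := X F /\ P F.
Let B F := X F /\ ~ P F.

Let bd_cutB i z G : chain X i z -> B G -> bd (cut B z) G = bd z G.
Proof.
move=> cz [XG nPG]; apply: eq_bd => j jG.
rewrite /cut; case: excluded_middle_informative => // nB.
case: (eqVneq (z (j |: G)) 0) => [->//|/cz[XF _]]; exfalso.
apply: nB; split=> // PF; apply: nPG; apply: (dP XF XG) => //.
exact: subsetUr.
Qed.

Let bdA0 i y G : chain A i y -> B G -> bd y G = 0.
Proof.
move=> cy [XG nPG]; apply: bd0 => j jG; apply: (chain0 cy) => -[XF PF].
by apply: nPG; apply: (dP XF XG) => //; apply: subsetUr.
Qed.

(** The differential passes to subsets, so by [dP] the sets in [A] span a subcomplex, with quotient
    spanned by [B]. This is the exactness of H_i(A) -> H_i(X) -> H_i(B). *)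
Lemma exact_ext_sub_quot i : exact A i -> exact B i -> exact X i.
Proof.
move=> eA eB z cz bz.
have czB : chain B i (cut B z).
  by move=> F; rewrite /cut; case: excluded_middle_informative => [BF /cz[]|_ /eqP].
case: (eB _ czB) => [G BG|y cy by_]; first by rewrite (bd_cutB cz)// bz//; case: BG.
have cyX : chain X i.+1 y by move=> F /cy[[]].
(* Subtracting the boundary of the lifted filling [y] leaves a cycle supported on [A]. *)
pose z' := cut X (fun F => z F - bd y F).
have z'E F : z' F = cut X z F - cut X (bd y) F.
  by rewrite /z' /cut; case: excluded_middle_informative => ?; rewrite ?subr0.
have cz' : chain A i z'.
  move=> F; rewrite /z' /cut; case: excluded_middle_informative => [XF nz|_ /eqP//].
  have PF : P F.
    apply: NNPP => nPF; case/eqP: nz; rewrite by_ ?cutT ?subrr//.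
  split=> //; case: (eqVneq (z F) 0) nz => [->|/cz[]//].
  rewrite sub0r oppr_eq0; exact: (chain_bd_card cyX).
case: (eA _ cz') => [G [XG PG]|y2 cy2 by2].
  rewrite (eq_bd (y := fun F => cut X z F - cut X (bd y) F)) => [|j _//].
  rewrite bdB (bd_cut cX cyX XG) subr0 -(bz G XG).
  by apply: eq_bd => j _; apply: (cut_chain _ cz).
exists (fun F => y F + y2 F) => [F|G XG].
  case: (eqVneq (y F) 0) => [->|/cyX//]; rewrite add0r => /cy2[[]]//.
rewrite bdD; case: (classic (P G)) => PG.
  by rewrite by2// /z' cutT// addrC subrK.
by rewrite (bdA0 cy2)// addr0 by_ ?cutT.
Qed.

(** Exactness of H_i(X) -> H_i(B) -> H_(i-1)(A). Quantifying over [i'] leaves no condition on [A]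
    when [i] is 0. *)
Lemma exact_quot i : exact X i -> (forall i', i = i'.+1 -> exact A i') ->
  exact B i.
Proof.
move=> eX eA z cz bz.
have czX : chain X i z by move=> F /cz[[]].
(* The part of the boundary of [z] lying in [A] represents the connecting class. Filling it by [y]
   makes [z - y] a cycle of [X]. *)
have [y cy byE] : exists2 y, chain A i y & forall G, A G -> bd y G = bd z G.
  case: i => [|i'] in eX eA cz czX *.
    exists (fun=> 0) => [F|G AG]; first by rewrite eqxx.
    rewrite !bd0// => j jG; apply/eqP; apply: contraT => /cz[_ /eqP].
    by rewrite cardsU1 jG.
  have cd : chain A i' (cut A (bd z)).
    move=> F; rewrite /cut; case: excluded_middle_informative => [AF nz|_ /eqP//].
    by split=> //; apply: (chain_bd_card cz).
  case: (eA _ erefl _ cd) => [G AG|y cy byE]; last first.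
    by exists y => // G AG; rewrite byE// cutT.
  rewrite -(bd_cut cX czX (proj1 AG)); apply: eq_bd => j jG.
  rewrite /cut; case: excluded_middle_informative => [AF|nAF].
    by case: excluded_middle_informative => // -[]; case: AF.
  case: excluded_middle_informative => // XF.
  by rewrite bz//; split=> // PF; apply: nAF.
have czy : chain X i (fun F => z F - y F).
  move=> F; case: (eqVneq (z F) 0) => [->|/czX//].
  by rewrite sub0r oppr_eq0 => /cy[[]].
case: (eX _ czy) => [G XG|x cx bx].
  rewrite bdB; case: (classic (P G)) => PG; first by rewrite byE// subrr.
  by rewrite bz// (bdA0 cy)// subr0.
exists (cut B x) => [F|G BG].
  by rewrite /cut; case: excluded_middle_informative => [BF /cx[]|_ /eqP].
rewrite (bd_cutB cx BG) bx; last by case: BG.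
by rewrite (chain0 cy) ?subr0// => -[_]; case: BG.
Qed.

End Split.

(** Exterior multiplication by e_j0 is a contracting homotopy, and it stays inside [X] because
    membership does not depend on [j0]. *)
Lemma exact_toggle X i (j0 : 'I_n) :
  (forall F, j0 \notin F -> X F <-> X (j0 |: F)) -> exact X i.
Proof.
move=> tX z cz bz.
exists (fun F => if j0 \in F then sgn (F :\ j0) j0 * z (F :\ j0) else 0).
  move=> F; case: ifPn => [j0F|_ /eqP//]; rewrite mulf_eq0 negb_or.
  case/andP=> _ /cz[XF cF]; have j0n : j0 \notin F :\ j0 by rewrite !inE eqxx.
  by move/(tX _ j0n): XF; rewrite setD1K// (cardsD1 j0 F) j0F cF.
move=> G XG; have [j0G|j0G] := boolP (j0 \in G); last first.
  rewrite /bd (bigD1 j0)//= setU11 big1 ?addr0 => [|j /andP[jG jj0]].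
    have -> : (j0 |: G) :\ j0 = G by rewrite setU1K.
    by rewrite mulrA sgn_sq mul1r.
  by rewrite !inE eq_sym (negPf jj0) (negPf j0G) mulr0.
pose G' := G :\ j0.
have j0G' : j0 \notin G' by rewrite !inE eqxx.
have GE : G = j0 |: G' by rewrite setD1K.
have /bz : X G' by apply/(tX _ j0G'); rewrite -GE.
rewrite /bd (bigD1 j0)//= -GE => /eqP; rewrite addr_eq0 => /eqP b0.
transitivity (- sgn G' j0 * \sum_(j | j \notin G) sgn G' j * z (j |: G')).
  rewrite mulr_sumr; apply: eq_bigr => j jG.
  have jj0 : j != j0 by apply: contraNneq jG => ->.
  have jG' : j \notin G' by rewrite !inE (negPf jG) andbF.
  rewrite !inE j0G orbT.
  have -> : (j |: G) :\ j0 = j |: G'.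
    by apply/setP=> k; rewrite !inE; case: (eqVneq k j0) => [->|]//=; rewrite eq_sym (negPf jj0).
  rewrite [in LHS]GE !sgnU//.
  have := jj0; rewrite neq_ltn => /orP[]jk; rewrite jk ltnNge (ltnW jk) /=; ring.
rewrite (eq_bigl (fun j => (j \notin G') && (j != j0))) => [|j]; last first.
  by rewrite GE !inE negb_or; case: (eqVneq j j0) => //=; rewrite ?andbT ?andbF.
by rewrite mulNr -mulrN -b0 mulrA sgn_sq mul1r.
Qed.

Lemma eq_exact X Y i : (forall F, X F <-> Y F) -> exact X i -> exact Y i.
Proof.
move=> XY eX z cz bz; case: (eX z) => [F /cz[/XY]|G /XY/bz|y cy hy] //.
by exists y => [F /cy[/XY]|G /XY/hy].
Qed.

End Chains.

(** * Betti numbers and exactness *)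

Section Betti.
Variables (K : fieldType) (n : nat).
Implicit Types (F G H : {set 'I_n}) (b : 'X_{1..n}) (gs : seq {mpoly K[n]}).

Definition kcoef gs b i F G : K :=
  if [&& kvalid gs b F, #|F| == i, kvalid gs b G, G \subset F
       & #|F :\: G| == 1%N]
  then (-1) ^+ #|[set k in G | [exists j in F :\: G, (k < j)%N]]| else 0.

Lemma koszul_mxE gs b i r c :
  koszul_mx gs b i r c = kcoef gs b i (enum_val r) (enum_val c).
Proof. by rewrite mxE. Qed.

Lemma koszul_sign G (j : 'I_n) : j \notin G ->
  #|[set k in G | [exists i in (j |: G) :\: G, (k < i)%N]]| =
  #|[set k in G | (k < j)%N]|.
Proof.
move=> jG; apply: eq_card => k; rewrite !inE; case: (k \in G) => //=.
apply/existsP/idP => [[i]|kj]; last by exists j; rewrite !inE eqxx jG kj.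
by rewrite !inE; case: eqP => [->|_] /andP[]; case: (i \in G) => //=; rewrite jG.
Qed.

Lemma kcoefU gs b i G j : j \notin G ->
  kcoef gs b i (j |: G) G =
  if [&& kvalid gs b (j |: G), #|G|.+1 == i & kvalid gs b G] then sgn K G j else 0.
Proof.
move=> jG; rewrite /kcoef koszul_sign// cardsU1 jG subsetUr.
have -> : (j |: G) :\: G = [set j].
  by apply/setP=> k; rewrite !inE; case: (eqVneq k j) => [->|_]; rewrite ?jG//= andNb.
by rewrite cards1 eqxx !andbT.
Qed.

Lemma kcoefN0 gs b i F G : kcoef gs b i F G != 0 -> exists2 j, j \notin G & F = j |: G.
Proof.
rewrite /kcoef; case: ifP => [/and5P[_ _ _ GF /cards1P[j E]] _|_ /eqP//].
have := set11 j; rewrite -E !inE => /andP[jG _]; exists j => //.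
by rewrite -[F](setID _ G) (setIidPr GF) E setUC.
Qed.

Lemma kcoef_sum gs b i z G :
  chain (fun F => kvalid gs b F) i z -> kvalid gs b G ->
  \sum_F z F * kcoef gs b i F G = bd z G.
Proof.
move=> cz vG; rewrite (bigID (mem [set j |: G | j in ~: G])) /= [X in _ + X]big1.
  rewrite addr0 big_imset /= => [|j k]; last first.
    rewrite !inE => jG kG /setP/(_ j); rewrite !inE eqxx (negPf jG) !orbF.
    by move/esym/eqP.
  apply: eq_big => [j|j]; rewrite ?inE// => jG; rewrite kcoefU// vG andbT mulrC.
  case: (eqVneq (z (j |: G)) 0) => [->|/cz[-> <-]]; first by rewrite !mulr0.
  by rewrite cardsU1 jG eqxx.
move=> F nF; apply/eqP; rewrite mulf_eq0; apply/orP; right.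
apply: contraNT nF => /kcoefN0[j jG ->]; apply/imsetP; exists j => //.
by rewrite inE.
Qed.

(** Its rows are the basis of the i-th chain group, in coordinates over all subsets. The row space
    is thus the chain group inside the larger space on which the Koszul matrices act. *)
Definition ksel gs b i : 'M[K]_(kchain_dim gs b i, #|{: {set 'I_n}}|) :=
  \matrix_(r, c) (enum_val r == enum_val c)%:R.

Lemma sum_enum_val (V : nmodType) (f : {set 'I_n} -> V) :
  \sum_(r < #|{: {set 'I_n}}|) f (enum_val r) = \sum_F f F.
Proof. by rewrite [RHS](reindex _ (onW_bij _ (enum_val_bij _))). Qed.

Lemma rank_ksel gs b i : \rank (ksel gs b i) = kchain_dim gs b i.
Proof.
apply/eqP; rewrite -/(row_free _); apply/row_freeP; exists (ksel gs b i)^T.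
apply/matrixP=> r c; rewrite !mxE; under eq_bigr do rewrite !mxE.
rewrite (sum_enum_val (fun F => (enum_val r == F)%:R * (enum_val c == F)%:R)).
rewrite (bigD1 (enum_val r))//= eqxx mul1r big1 => [|F /negPf nF].
  by rewrite addr0 (inj_eq enum_val_inj) eq_sym.
by rewrite eq_sym nF mul0r.
Qed.

Lemma sub_kselP gs b i (u : 'rV_#|{: {set 'I_n}}|) :
  reflect (forall c, u 0 c != 0 -> kvalid gs b (enum_val c) /\ #|enum_val c| = i)
    (u <= ksel gs b i)%MS.
Proof.
apply: (iffP idP) => [/submxP[v ->] c|Hu].
  rewrite mxE => nz.
  have [r] : exists r, ksel gs b i r c != 0.
    apply/existsP; apply: contraNT nz => /existsPn h.
    apply/eqP; apply: big1 => r _; move: (h r) => /negPn/eqP => ->; by rewrite mulr0.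
  rewrite mxE; case: (enum_val r =P enum_val c) => [<- _|_ /eqP//].
  by have := enum_valP r; rewrite inE => /andP[-> /eqP->].
rewrite [u]row_sum_delta; apply: summx_sub => c _.
have [->|/Hu[vc ic]] := eqVneq (u 0 c) 0; first by rewrite scale0r sub0mx.
have cC : enum_val c \in [set F : {set 'I_n} | kvalid gs b F & #|F| == i].
  by rewrite inE vc ic eqxx.
apply: scalemx_sub; apply: (submx_trans _ (row_sub (enum_rank_in cC (enum_val c)) _)).
rewrite (_ : row _ _ = delta_mx 0 c) ?submx_refl//; apply/rowP=> d.
rewrite !mxE enum_rankK_in// (inj_eq enum_val_inj) eqxx eq_sym //.
Qed.

Lemma exact_betti gs b i : exact K (fun F => kvalid gs b F) i -> betti gs i b = 0%N.
Proof.
move=> eX; rewrite /betti.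
(* Cycles of degree i are boundaries; rank-nullity for d_i restricted to the chain group then makes
   the Betti number 0. *)
suff sE : (ksel gs b i :&: kermx (koszul_mx gs b i) <= koszul_mx gs b i.+1)%MS.
  have := mxrank_mul_ker (ksel gs b i) (koszul_mx gs b i); rewrite rank_ksel.
  have := mxrankS sE; have := mxrankM_maxr (ksel gs b i) (koszul_mx gs b i); lia.
apply/rV_subP => u; rewrite sub_capmx => /andP[/sub_kselP Hu /sub_kermxP u0].
pose z F := u 0 (enum_rank F).
have cz : chain (fun F => kvalid gs b F) i z.
  by move=> F /Hu; rewrite enum_rankK.
case: (eX z cz) => [G vG|y cy by_].
  have := congr1 (fun M : 'rV_ _ => M 0 (enum_rank G)) u0; rewrite !mxE => <-.
  rewrite -(kcoef_sum cz vG) -sum_enum_val; apply: eq_bigr => r _.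
  by rewrite koszul_mxE enum_rankK /z enum_valK.
apply/submxP; exists (\row_r y (enum_val r)); apply/rowP => c; rewrite !mxE.
under eq_bigr do rewrite koszul_mxE mxE.
rewrite (sum_enum_val (fun F => y F * kcoef gs b i.+1 F (enum_val c))).
have [vc|nvc] := boolP (kvalid gs b (enum_val c)).
  by rewrite (kcoef_sum cy vc) by_// /z enum_valK.
rewrite big1 => [|F _]; last by rewrite /kcoef (negPf nvc) !andbF mulr0.
by apply/eqP; apply: contraNT nvc => /Hu[].
Qed.

(* The sum of coefficients is a cocycle, so a basis element of minimal
   degree is not a boundary. *)
Lemma betti_neq0 gs b i F0 : kvalid gs b F0 -> #|F0| = i ->
  (forall F, kvalid gs b F -> (i <= #|F|)%N) ->
  (forall H, kvalid gs b H -> #|H| = i.+1 ->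
     \sum_(j | (j \in H) && kvalid gs b (H :\ j)) sgn K (H :\ j) j = 0) ->
  betti gs i b <> 0%N.
Proof.
move=> v0 c0 vmin sum0.
(* By minimality of [i] there is no chain in degree i - 1. *)
have D0 : koszul_mx gs b i = 0.
  apply/matrixP=> r c; rewrite koszul_mxE mxE; apply/eqP; apply: contraT => nz.
  have [j jG FE] := kcoefN0 nz; move: nz; rewrite FE kcoefU//.
  by case: ifP => [/and3P[_ /eqP iE /vmin]|_ /eqP//]; rewrite -iE ltnn.
rewrite /betti D0 mxrank0 subn0 => /eqP; rewrite subn_eq0 => le.
have sEA : (koszul_mx gs b i.+1 <= ksel gs b i)%MS.
  apply/row_subP => r; apply/sub_kselP => c; rewrite mxE koszul_mxE => nz.
  have [j jG FE] := kcoefN0 nz; move: nz; rewrite FE kcoefU//.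
  by case: ifP => [/and3P[_ /eqP[<-] ->]|_ /eqP//].
(* If the Betti number vanished, the image of d_(i+1) would be the whole chain group, so the sum of
   coefficients, which kills boundaries, would also kill e_F0. *)
have /submxP[W AE] : (ksel gs b i <= koszul_mx gs b i.+1)%MS.
  by rewrite -(mxrank_leqif_sup sEA) eqn_leq rank_ksel le -{1}(rank_ksel gs b i) mxrankS.
have E0 : koszul_mx gs b i.+1 *m const_mx 1 = 0 :> 'cV_ _.
  apply/colP => r; rewrite !mxE; set H := enum_val r.
  under eq_bigr do rewrite koszul_mxE [const_mx _ _ _]mxE mulr1.
  rewrite (sum_enum_val (fun G => kcoef gs b i.+1 H G)).
  have [/andP[vH /eqP cH]|nH] := boolP (kvalid gs b H && (#|H| == i.+1)); last first.
    by rewrite big1// => G _; rewrite /kcoef andbA (negPf nH).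
  rewrite (bigID (mem [set H :\ j | j in H])) /= [X in _ + X]big1 ?addr0 => [|G nG].
    rewrite big_imset /= => [|j k jH kH /setP/(_ j)]; last first.
      by rewrite !inE eqxx jH !andbT /=; move/esym/negbT; rewrite negbK => /eqP.
    rewrite -[RHS](sum0 H vH cH) [RHS]big_mkcondr; apply: eq_bigr => j jH.
    rewrite -{1}(setD1K jH) kcoefU ?setD1K ?inE ?eqxx// vH /=.
    by have := cH; rewrite (cardsD1 j) jH add1n => ->; rewrite eqxx.
  apply/eqP; apply: contraNT nG => /kcoefN0[j jG ->].
  by apply/imsetP; exists j; rewrite ?setU11// setU1K.
have : ksel gs b i *m const_mx 1 = 0 :> 'cV_ _ by rewrite AE -mulmxA E0 mulmx0.
have F0C : F0 \in [set F : {set 'I_n} | kvalid gs b F & #|F| == i].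
  by rewrite inE v0 c0 eqxx.
move/colP/(_ (enum_rank_in F0C F0)); rewrite !mxE.
under eq_bigr do rewrite !mxE enum_rankK_in// mulr1.
rewrite (sum_enum_val (fun F => (F0 == F)%:R)) (bigD1 F0)//= eqxx big1 => [|F].
  by rewrite addr0 => /eqP; rewrite oner_eq0.
by rewrite eq_sym => /negPf->.
Qed.

End Betti.

(** * Regularity of monomial ideals *)

Section Regularity.
Variables (K : fieldType) (n : nat).
Implicit Types (F G H : {set 'I_n}) (m b u : 'X_{1..n}).
Implicit Types (M : 'X_{1..n} -> Prop).

Definition up_closed M := forall m m', (m <= m')%MM -> M m -> M m'.

Definition kset M b F := (forall j, j \in F -> (0 < b j)%N) /\ ~ M (msubset b F).

(** reg (S/M) <= r for the monomial ideal whose monomials have their exponents in [M], as vanishing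
    of Koszul homology in each multidegree. *)
Definition regle M r := forall i b, (i + r < mdeg b)%N -> exact K (kset M b) i.

Lemma msubsetE b F j : msubset b F j = (b j - (j \in F))%N.
Proof. exact: mnmE. Qed.

Lemma msubset_anti b F G : F \subset G -> (msubset b G <= msubset b F)%MM.
Proof.
move=> FG; apply/mnm_lepP => j; rewrite !msubsetE leq_sub2l//.
by case: (boolP (j \in F)) => // /(subsetP FG)->.
Qed.

Lemma kset_convex M b : up_closed M -> convex (kset M b).
Proof.
move=> uM F G H [_ nF] [sH _] FG GH; split=> [j jG|MG].
  by apply: sH; apply: (subsetP GH).
by apply: nF; apply: uM MG; apply: msubset_anti.
Qed.

(** Multiplication by x^u identifies the Koszul complex of S/(M : x^u) in degree b - u with the
    subcomplex, in degree b, of the e_F x^(b - F) with x^(b - F) divisible by x^u. *)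
Lemma kset_colon M u b F : (u <= b)%MM ->
  kset (fun m => M (m + u)%MM) (b - u)%MM F <->
  kset M b F /\ (u <= msubset b F)%MM.
Proof.
move=> /mnm_lepP ub.
have E : (forall j, j \in F -> (u j < b j)%N) ->
    (msubset (b - u)%MM F + u)%MM = msubset b F.
  move=> h; apply/mnmP => j; rewrite mnmDE !msubsetE mnmBE; have := ub j.
  by case: (boolP (j \in F)) => [/h|]; lia.
split=> [[sF nM]|[[sF nM] /mnm_lepP uF]].
  have h j : j \in F -> (u j < b j)%N by move=> /sF; rewrite mnmBE; lia.
  split; last by apply/mnm_lepP => j; rewrite -E// mnmDE leq_addl.
  by rewrite /kset -E//; split=> // j /h; lia.
have h j : j \in F -> (u j < b j)%N.
  by move=> jF; have := uF j; have := sF j jF; rewrite msubsetE jF; lia.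
by split=> [j /h|]; rewrite ?E// mnmBE; lia.
Qed.

Lemma kset_add M u b F :
  kset (fun m => M m \/ (u <= m)%MM) b F <->
  kset M b F /\ ~ (u <= msubset b F)%MM.
Proof. by rewrite /kset; tauto. Qed.

Lemma exact_empty (X : {set 'I_n} -> Prop) i :
  (forall F, X F -> #|F| <> i) -> exact K X i.
Proof.
move=> X0 z cz _; have z0 F : z F = 0.
  by case: (eqVneq (z F) 0) => [//|/cz[XF cF]]; case: (X0 _ XF).
by exists (fun=> 0) => [F|G XG]; rewrite ?eqxx// z0 bd0.
Qed.

Lemma exact_colon M u r1 r b i : regle (fun m => M (m + u)%MM) r1 ->
  (r1 + mdeg u <= r)%N -> (i + r < mdeg b)%N ->
  exact K (fun F => kset M b F /\ (u <= msubset b F)%MM) i.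
Proof.
move=> rM le lt; have [ub|nub] := boolP (u <= b)%MM.
  apply: eq_exact (rM i (b - u)%MM _) => [F|]; first exact: kset_colon.
  by have := mdegD (b - u) u; rewrite submK//; lia.
apply: exact_empty => F [_ uF]; case/negP: nub; apply: (lepm_trans uF).
by apply/mnm_lepP => j; rewrite msubsetE leq_subr.
Qed.

Lemma split_down M u b F G : kset M b F -> kset M b G -> G \subset F ->
  (u <= msubset b F)%MM -> (u <= msubset b G)%MM.
Proof. by move=> _ _ GF uF; apply: (lepm_trans uF); apply: msubset_anti. Qed.

(* From 0 -> S/(M : x^u)(-u) -> S/M -> S/(M + x^u) -> 0. *)
Lemma regle_split M u r1 r : up_closed M ->
  regle (fun m => M (m + u)%MM) r1 -> (r1 + mdeg u <= r)%N ->
  regle (fun m => M m \/ (u <= m)%MM) r -> regle M r.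
Proof.
move=> uM rC le rA i b lt.
apply: (exact_ext_sub_quot (P := fun F => (u <= msubset b F)%MM)).
- exact: kset_convex.
- by move=> F G; apply: split_down.
- exact: exact_colon rC le lt.
- by apply: eq_exact (rA _ _ lt) => F; apply: kset_add.
Qed.

(** The same short exact sequence, read at the quotient: the connecting map lands in homological
    degree i - 1, which accounts for the [r.+1]. *)
Lemma regle_add M u r1 r : up_closed M ->
  regle (fun m => M (m + u)%MM) r1 -> (r1 + mdeg u <= r.+1)%N ->
  regle M r -> regle (fun m => M m \/ (u <= m)%MM) r.
Proof.
move=> uM rC le rM i b lt.
apply: (@eq_exact _ _ (fun F => kset M b F /\ ~ (u <= msubset b F)%MM)).
  by move=> F; symmetry; apply: kset_add.
apply: exact_quot; [exact: kset_convex|by move=> F G; apply: split_down|exact: rM|].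
by move=> i' E; apply: exact_colon rC le _; lia.
Qed.

Lemma eq_regle M M' r : (forall m, M m <-> M' m) -> regle M r -> regle M' r.
Proof.
move=> MM rM i b lt; apply: eq_exact (rM i b lt) => F.
by rewrite /kset MM.
Qed.

Lemma regle_le M r r' : (r <= r')%N -> regle M r -> regle M r'.
Proof. by move=> le rM i b lt; apply: rM; lia. Qed.

Lemma regle_unit M r : (forall m, M m) -> regle M r.
Proof. by move=> MT i b _; apply: exact_empty => F [_]; have := MT (msubset b F). Qed.

(** If b involves a variable outside V, toggling that variable contracts the complex. Otherwise b -
    F must be 0, so b is the indicator of F and has degree i. *)
Lemma regle_vars (V : pred 'I_n) : regle (fun m => exists2 j, V j & (0 < m j)%N) 0.
Proof.
move=> i b; rewrite addn0 => lt.
have [[j Vj bj]|nb] := classic (exists2 j, ~~ V j & (0 < b j)%N).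
  apply: (exact_toggle (j0 := j)) => F jF; split=> -[sF nM]; split.
  - by move=> k; rewrite !inE => /orP[/eqP->//|/sF].
  - move=> [k Vk]; rewrite msubsetE !inE; case: eqVneq => [E|_]/= h.
      by rewrite -E Vk in Vj.
    by apply: nM; exists k => //; rewrite msubsetE.
  - by move=> k kF; apply: sF; rewrite inE kF orbT.
  - move=> [k Vk]; rewrite msubsetE => h; apply: nM; exists k => //.
    rewrite msubsetE !inE; case: eqVneq => [E|_] //.
    by rewrite -E Vk in Vj.
apply: exact_empty => F [sF nM] cF; suff : mdeg b = i by lia.
rewrite mdegE -cF -sum1_card [RHS]big_mkcond; apply: eq_bigr => j _.
have [Vj|nVj] := boolP (V j).
  have : msubset b F j = 0%N.
    by apply/eqP; apply: contraT; rewrite -lt0n => h; case: nM; exists j.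
  by rewrite msubsetE; case: (boolP (j \in F)) => [/sF|_] /=; lia.
have b0 : b j = 0%N by apply/eqP; apply: contraT; rewrite -lt0n => h; case: nb; exists j.
by case: ifP => // /sF; rewrite b0.
Qed.

End Regularity.

(** * From generators to predicates on exponents *)

Section MonomialIdeals.
Variables (K : fieldType) (n : nat).
Implicit Types (m u : 'X_{1..n}) (gs : seq {mpoly K[n]}).

Definition mon_dvd gs m := exists2 u, 'X_[u] \in gs & (u <= m)%MM.

Lemma mon_in_dvd gs m : monomial_gens gs -> mon_in gs m <-> mon_dvd gs m.
Proof.
move=> mg; rewrite /mon_in; case: excluded_middle_informative => [im|nim]; split=> //.
  move=> _; case: im => cs [_ E].
  have : 'X_[m]@_m != 0 :> K by rewrite mcoeffX eqxx oner_neq0.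
  rewrite E raddf_sum /= => nz.
  have [i] : exists i : 'I_(size gs), (cs`_i * gs`_i)@_m != 0.
    by apply/existsP; apply: contraNT nz => /existsPn h; rewrite big1// => i _; apply/eqP/negPn.
  have gi : gs`_i \in gs by rewrite mem_nth.
  have [u ug] := mg _ gi; rewrite ug -mcoeff_msupp => h; exists u; first by rewrite -ug.
  move: h; rewrite (perm_mem (msuppMX _ _)) => /mapP[v _ ->]; exact: lem_addr.
move=> [u ug um]; case: nim.
exists (mkseq (fun i => if i == index 'X_[u] gs then 'X_[m - u] else 0) (size gs)).
split; first by rewrite size_mkseq.
have lt : (index 'X_[u] gs < size gs)%N by rewrite index_mem.
rewrite (bigD1 (Ordinal lt))//= nth_mkseq// eqxx nth_index// -mpolyXD submK//.
rewrite big1 ?addr0// => i; rewrite -val_eqE /= => /negPf ni.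
by rewrite nth_mkseq// ni mul0r.
Qed.

Lemma kvalidE gs M b (F : {set 'I_n}) : (forall m, mon_in gs m <-> M m) ->
  kvalid gs b F <-> kset M b F.
Proof.
move=> E; rewrite /kvalid /kset -E; split=> [/andP[/forall_inP sF /negP nM]|[sF /negP nM]].
  by split.
by rewrite nM andbT; apply/forall_inP.
Qed.

Lemma regle_reg_le gs M r : (forall m, mon_in gs m <-> M m) ->
  regle K M r -> reg_le gs r.
Proof.
move=> E rM i b bt; rewrite leqNgt; apply/negP => lt; apply: bt.
apply: exact_betti; apply: eq_exact (rM i b lt) => F.
by symmetry; apply: kvalidE.
Qed.

End MonomialIdeals.

(** * Exponent functions and unweighted paths *)

Section Exponents.
Variables (n : nat).
Implicit Types (m u : 'X_{1..n}).

Definition ev m (v : nat) : nat := nth 0%N m v.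

Lemma evE m (i : 'I_n) : ev m i = m i.
Proof. by rewrite /ev -mnm_nth. Qed.

Lemma ev_ge m v : (n <= v)%N -> ev m v = 0%N.
Proof. by move=> h; rewrite /ev nth_default// size_tuple. Qed.

Lemma evD m u v : ev (m + u)%MM v = (ev m v + ev u v)%N.
Proof.
case: (ltnP v n) => [lt|ge]; last by rewrite !ev_ge.
by rewrite -[v]/(nat_of_ord (Ordinal lt)) !evE mnmDE.
Qed.

Lemma evB m u v : ev (m - u)%MM v = (ev m v - ev u v)%N.
Proof.
case: (ltnP v n) => [lt|ge]; last by rewrite !ev_ge.
by rewrite -[v]/(nat_of_ord (Ordinal lt)) !evE mnmBE.
Qed.

Lemma lem_evP m u : (m <= u)%MM <-> forall v, (ev m v <= ev u v)%N.
Proof.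
split=> [/mnm_lepP h v|h]; last by apply/mnm_lepP => i; rewrite -!evE.
case: (ltnP v n) => [lt|ge]; last by rewrite !ev_ge.
by have := h (Ordinal lt); rewrite -!evE.
Qed.

Definition mon_of (f : nat -> nat) : 'X_{1..n} := [multinom f i | i < n].

Lemma ev_mon_of f v : ev (mon_of f) v = if (v < n)%N then f v else 0%N.
Proof.
case: ltnP => [lt|ge]; last by rewrite ev_ge.
by rewrite -[v]/(nat_of_ord (Ordinal lt)) evE mnmE.
Qed.

Lemma mdeg_mon_of f : mdeg (mon_of f) = (\sum_(0 <= v < n) f v)%N.
Proof. by rewrite mdegE big_mkord; apply: eq_bigr => i _; rewrite mnmE. Qed.

(** The exponent function of (x_k x_(k+1))^c. *)
Definition edge (k c v : nat) : nat := (c * ((v == k) || (v == k.+1)))%N.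

Definition raise (f : nat -> nat) k c v : nat := (f v + edge k c v)%N.

Definition raise1 (f : nat -> nat) k v : nat := (f v + (v == k))%N.

Lemma sum_delta k : (k < n)%N -> (\sum_(0 <= v < n) (v == k))%N = 1%N.
Proof.
move=> kn; rewrite big_mkord (bigD1 (Ordinal kn))//= eqxx big1// => i.
by rewrite -val_eqE /= => /negPf->.
Qed.

Lemma mdeg_edge k c : (k.+1 < n)%N -> mdeg (mon_of (edge k c)) = (2 * c)%N.
Proof.
move=> kn; rewrite mdeg_mon_of -big_distrr /=.
rewrite (eq_bigr (fun v => (v == k) + (v == k.+1))%N) => [|v _]; last first.
  by case: (eqVneq v k) => [->|//]; rewrite -[k == k.+1]/(k == 1 + k)%N; lia.
by rewrite big_split /= !sum_delta//; lia.
Qed.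

Lemma ev_edge k c v : (k.+1 < n)%N -> ev (mon_of (edge k c)) v = edge k c v.
Proof.
move=> kn; rewrite ev_mon_of; case: ltnP => // ge; rewrite /edge.
by rewrite !gtn_eqF ?muln0//; lia.
Qed.

Lemma edge_leP k c m : (k.+1 < n)%N ->
  (mon_of (edge k c) <= m)%MM <-> (c <= ev m k)%N /\ (c <= ev m k.+1)%N.
Proof.
move=> kn; rewrite lem_evP; split=> [h|[h1 h2] v].
  have := h k; have := h k.+1; rewrite !ev_edge// /edge !eqxx orbT !muln1; lia.
rewrite ev_edge// /edge; case: eqP => [->|_]; first by rewrite muln1.
by case: eqP => [->|_]; rewrite ?muln1 ?muln0.
Qed.

Lemma ev_raise m k c v : (k.+1 < n)%N ->
  ev (m + mon_of (edge k c))%MM v = raise (ev m) k c v.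
Proof. by move=> kn; rewrite evD ev_edge. Qed.

End Exponents.

(* Monomial ideals are described by predicates on the exponent function
   [v |-> exponent of the v-th variable], which vanishes from [n] on. *)
Section FunReg.
Variables (K : fieldType) (n : nat).
Implicit Types (f g : nat -> nat) (P Q : (nat -> nat) -> Prop).

Definition mono P := forall f g, (forall v, (f v <= g v)%N) -> P f -> P g.

Definition freg P r := regle K (fun m : 'X_{1..n} => P (ev m)) r.

Lemma mono_up P : mono P -> up_closed (fun m : 'X_{1..n} => P (ev m)).
Proof. by move=> mP m m' /lem_evP le; apply: mP. Qed.

Lemma eq_freg P Q r :
  (forall f, (forall v, (n <= v)%N -> f v = 0%N) -> P f <-> Q f) ->
  freg P r -> freg Q r.
Proof. by move=> E; apply: eq_regle => m; apply: E => v; apply: ev_ge. Qed.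

Lemma freg_colon_edge P k c r : mono P -> (k.+1 < n)%N ->
  freg (fun f => P (raise f k c)) r ->
  regle K (fun m : 'X_{1..n} => P (ev (m + mon_of n (edge k c))%MM)) r.
Proof.
move=> mP kn; apply: eq_regle => m.
by split; apply: mP => v; rewrite ev_raise.
Qed.

Lemma freg_split P k c r1 r : mono P -> (k.+1 < n)%N ->
  freg (fun f => P (raise f k c)) r1 -> (r1 + 2 * c <= r)%N ->
  freg (fun f => P f \/ (c <= f k)%N /\ (c <= f k.+1)%N) r -> freg P r.
Proof.
move=> mP kn rC le rA.
apply: (regle_split (mono_up mP) (freg_colon_edge mP kn rC)).
  by rewrite mdeg_edge.
by apply: eq_regle rA => m; rewrite edge_leP.
Qed.

Lemma freg_add P k c r1 r : mono P -> (k.+1 < n)%N ->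
  freg (fun f => P (raise f k c)) r1 -> (r1 + 2 * c <= r.+1)%N ->
  freg P r -> freg (fun f => P f \/ (c <= f k)%N /\ (c <= f k.+1)%N) r.
Proof.
move=> mP kn rC le rP.
have := regle_add (mono_up mP) (freg_colon_edge mP kn rC) _ rP.
rewrite mdeg_edge// => /(_ le); apply: eq_regle => m; by rewrite edge_leP.
Qed.

Lemma freg_split1 P k r1 r : mono P -> (k < n)%N ->
  freg (fun f => P (raise1 f k)) r1 -> (r1 < r)%N ->
  freg (fun f => P f \/ (0 < f k)%N) r -> freg P r.
Proof.
move=> mP kn rC le rA.
have U v : ev (mon_of n (fun v => v == k)) v = (v == k).
  by rewrite ev_mon_of; case: ltnP => // ge; rewrite gtn_eqF//; lia.
apply: (regle_split (mono_up mP) (u := mon_of n (fun v => v == k)) (r1 := r1)).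
- by apply: eq_regle rC => m; split; apply: mP => v; rewrite evD U.
- by rewrite mdeg_mon_of sum_delta// addn1.
apply: eq_regle rA => m; rewrite lem_evP; suff -> : (0 < ev m k)%N <->
    forall v, (ev (mon_of n (fun v => v == k)) v <= ev m v)%N by [].
split=> [h v|/(_ k)]; last by rewrite U eqxx.
by rewrite U; case: eqP => [->|].
Qed.

Lemma freg_le P r r' : (r <= r')%N -> freg P r -> freg P r'.
Proof. exact: regle_le. Qed.

Definition vars (V : pred nat) f : Prop := exists2 v, V v & (0 < f v)%N.

(** The bound k + 1 < n is implicit, since exponents vanish from n on. *)
Definition edges_from s f : Prop :=
  exists k, [/\ (s <= k)%N, (0 < f k)%N & (0 < f k.+1)%N].

Definition tail_path s V f : Prop := vars V f \/ edges_from s f.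

Lemma mono_or P Q : mono P -> mono Q -> mono (fun f => P f \/ Q f).
Proof. by move=> mP mQ f g le [/(mP _ _ le)|/(mQ _ _ le)]; auto. Qed.

Lemma mono_edge k c : mono (fun f => (c <= f k)%N /\ (c <= f k.+1)%N).
Proof.
by move=> f g le [h1 h2]; split; [apply: leq_trans (le _)|apply: leq_trans (le _)].
Qed.

Lemma mono_vars V : mono (vars V).
Proof. by move=> f g le [v Vv h]; exists v => //; apply: leq_trans (le v). Qed.

Lemma mono_edges_from s : mono (edges_from s).
Proof.
by move=> f g le [k [sk h1 h2]]; exists k; split=> //;
  [apply: leq_trans (le _)|apply: leq_trans (le _)].
Qed.

Lemma mono_tail_path s V : mono (tail_path s V).
Proof. apply: mono_or; [exact: mono_vars|exact: mono_edges_from]. Qed.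

Lemma vars_reg V : freg (vars V) 0.
Proof.
apply: (eq_regle _ (@regle_vars K n (fun i => V i))) => m.
split=> [[i Vi mi]|[v Vv h]]; first by exists i; rewrite ?evE.
have vn : (v < n)%N by rewrite ltnNge; apply/negP => /(ev_ge m) E; rewrite E in h.
by exists (Ordinal vn); rewrite -?evE.
Qed.

(** The classical value for a path on n - s vertices, by splitting at x_(s+1): the colon turns x_s
    and x_(s+2) into variables and leaves the path from s + 3, while adding x_(s+1) leaves the path
    from s + 2. *)
Lemma tail_path_reg s V : freg (tail_path s V) ((n - s + 1) %/ 3).
Proof.
have [d] := ubnP (n - s); elim: d => // d IH in s V *; rewrite ltnS => led.
have [ge|lt] := leqP n s.+1.
  apply: (@freg_le _ 0) => //; apply: eq_freg (@vars_reg V) => f f0.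
  split=> [h|[//|[k [sk _]]]]; first by left.
  by rewrite f0//; lia.
have [V1|V1] := boolP (V s.+1).
  apply: (@freg_le _ ((n - s.+2 + 1) %/ 3)); first by apply: leq_div2r; lia.
  apply: eq_freg (IH s.+2 V _) => [f f0|]; last lia.
  split=> [[h|[k [sk h1 h2]]]|[h|[k [sk h1 h2]]]]; try by left.
    by right; exists k; split=> //; lia.
  have [E|Nk] := eqVneq k s; first by left; exists s.+1; rewrite // -E.
  have [E|Nk1] := eqVneq k s.+1; first by left; exists s.+1; rewrite // -E.
  by right; exists k; split=> //; lia.
apply: (@freg_split1 _ s.+1 ((n - s.+3 + 1) %/ 3)) => //.
- exact: mono_tail_path.
- apply: eq_freg (IH s.+3 (predU V (pred2 s s.+2)) _) => [f f0|]; last lia.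
  split=> [[[v /= Vv h]|[k [sk h1 h2]]]|[[v Vv h]|[k [sk h1 h2]]]].
  + case/orP: Vv => [Vv|/orP[/eqP E|/eqP E]].
    * by left; exists v; rewrite // /raise1; lia.
    * by right; exists s; split; rewrite // /raise1; subst v; lia.
    * by right; exists s.+1; split; rewrite // /raise1; subst v; lia.
  + by right; exists k; split; rewrite // /raise1; lia.
  + left; exists v; first by rewrite /= Vv.
    by move: h; rewrite /raise1; case: eqP => [E|]; [rewrite -E Vv in V1|rewrite addn0].
  + move: h1 h2; rewrite /raise1 => h1 h2.
    have [E|Nk] := eqVneq k s; first by left; exists s; rewrite /= ?eqxx ?orbT//; subst k; lia.
    have [E|Nk1] := eqVneq k s.+1.
      by left; exists s.+2; rewrite /= ?eqxx ?orbT//; subst k; lia.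
    have [E|Nk2] := eqVneq k s.+2.
      by left; exists s.+2; rewrite /= ?eqxx ?orbT//; subst k; lia.
    by right; exists k; split; lia.
- lia.
apply: (@freg_le _ ((n - s.+2 + 1) %/ 3)); first by apply: leq_div2r; lia.
apply: eq_freg (IH s.+2 (predU V (pred1 s.+1)) _) => [f f0|]; last lia.
split=> [[[v /= Vv h]|[k [sk h1 h2]]]|[[[v Vv h]|[k [sk h1 h2]]]|h]].
+ case/orP: Vv => [Vv|/eqP E]; last by right; rewrite -E.
  by left; left; exists v.
+ by left; right; exists k; split=> //; lia.
+ by left; exists v; rewrite /= ?Vv.
+ have [E|Nk] := eqVneq k s; first by left; exists s.+1; rewrite /= ?eqxx ?orbT// -E.
  have [E|Nk1] := eqVneq k s.+1.
    by left; exists s.+1; rewrite /= ?eqxx ?orbT// -E.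
  by right; exists k; split=> //; lia.
+ by left; exists s.+1; rewrite /= ?eqxx ?orbT.
Qed.

End FunReg.

(** * Powers of the initial edges *)

Section Powers.
Variable (w : nat -> nat).
Implicit Types (f : nat -> nat) (c : nat -> nat).

(* Exponent of the v-th variable in the product of the [e_k ^ c k]. *)
Definition load c v : nat := ((if v is v'.+1 then c v' * w v' else 0) + c v * w v)%N.

(** Membership in the q-th power of the ideal of the first j weighted edges: [c k] is the number of
    factors e_k. Requiring [c] to vanish from j on makes [load] the exponent of that product
    alone. *)
Definition powers j q f : Prop := exists c,
  [/\ (\sum_(0 <= k < j) c k = q)%N, forall k, (j <= k)%N -> c k = 0%N &
      forall v, (load c v <= f v)%N].

Lemma mono_powers j q : mono (powers j q).
Proof.
move=> f g le [c [s z h]]; exists c; split=> // v; exact: leq_trans (le v).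
Qed.

Lemma powers0 j f : powers j 0 f.
Proof.
exists (fun=> 0%N); split=> // [|v]; first by rewrite big1.
by rewrite /load; case: v.
Qed.

Definition inc c i k : nat := (c k + (k == i))%N.
Definition dec c i k : nat := (c k - (k == i))%N.

Lemma sum_inc c i j : (i < j)%N ->
  (\sum_(0 <= k < j) inc c i k = (\sum_(0 <= k < j) c k).+1)%N.
Proof. by move=> ij; rewrite big_split /= sum_delta// addn1. Qed.

Lemma sum_dec c i j : (i < j)%N -> (0 < c i)%N ->
  (\sum_(0 <= k < j) dec c i k = (\sum_(0 <= k < j) c k).-1)%N.
Proof.
move=> ij ci; rewrite -[LHS]/(_.+1.-1) -(sum_inc _ ij); congr _.-1.
by apply: eq_bigr => k _; rewrite /inc /dec subnK//; case: eqP => [->|].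
Qed.

Lemma incM c i k x : (inc c i k * x = c k * x + (k == i) * x)%N.
Proof. exact: mulnDl. Qed.

Lemma decM c i k x : (dec c i k * x = c k * x - (k == i) * x)%N.
Proof. exact: mulnBl. Qed.

Lemma load_inc c i v : load (inc c i) v = (load c v + edge i (w i) v)%N.
Proof.
rewrite /load /edge /inc; case: v => [|v]; rewrite ?mulnDl ?eqSS.
  by case: (eqVneq 0%N i) => [<-|_] /=; lia.
have [<-|_] := eqVneq v i.
  have vv : (v.+1 == v) = false by lia.
  by rewrite vv; lia.
by have [<-|_] := eqVneq v.+1 i; rewrite /=; lia.
Qed.

Lemma load_dec c i v : (0 < c i)%N -> load c v = (load (dec c i) v + edge i (w i) v)%N.
Proof.
move=> ci; rewrite -load_inc /load.
by case: v => [|v]; rewrite !incM !decM; do !case: eqP => [E|_]; subst; nia.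
Qed.

Lemma load_ge c v k : ((v == k) || (v == k.+1)) -> (c k * w k <= load c v)%N.
Proof. by case/orP=> /eqP->; rewrite /load; [case: k => [|k]|]; lia. Qed.

Lemma sum_pos c j q : (\sum_(0 <= k < j) c k)%N = q.+1 -> exists2 i, (i < j)%N & (0 < c i)%N.
Proof.
elim: j => [|j IH]; first by rewrite big_geq.
rewrite big_nat_recr//=; case: (posnP (c j)) => [->|cj _]; last by exists j.
by rewrite addn0 => /IH[i ij ci]; exists i => //; lia.
Qed.

(** Cancellation of one factor: if a product of q + 1 edges containing e_i divides f e_i, then the
    product of the other q divides f. *)
Lemma powers_dec j q c i f : (i < j)%N -> (0 < c i)%N ->
  (\sum_(0 <= k < j) c k)%N = q.+1 -> (forall k, (j <= k)%N -> c k = 0%N) ->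
  (forall v, (load c v <= f v + edge i (w i) v)%N) -> powers j q f.
Proof.
move=> ij ci s z h; exists (dec c i); split=> [|k jk|v].
- by rewrite sum_dec// s.
- by rewrite /dec z// sub0n.
by have := h v; rewrite (load_dec v ci) leq_add2r.
Qed.

Lemma powersS j q f i : (i < j)%N -> powers j q f -> powers j q.+1 (raise f i (w i)).
Proof.
move=> ij [c [s z h]]; exists (inc c i); split=> [|k jk|v].
- by rewrite sum_inc// s.
- by rewrite /inc z// gtn_eqF//; lia.
by rewrite load_inc leq_add2r.
Qed.

(** A product containing e_j loses that factor. One without e_j does not involve the leaf x_(j+1),
    so only one power of x_j has to be recovered, and dropping a suitable factor does this. *)
Lemma powers_colon_leaf j q f : (forall k, (k < j)%N -> (0 < w k)%N) -> w j = 1%N ->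
  powers j.+1 q.+1 (raise f j 1) <-> powers j.+1 q f.
Proof.
move=> wp wj; split=> [[c [s z h]]|/(powersS (ltnSn j))]; last by rewrite wj.
have [cj|cj] := posnP (c j); last first.
  by apply: (powers_dec (ltnSn j) cj s z) => v; have := h v; rewrite wj.
have [i ij ci] : exists2 i, (i < j.+1)%N & (0 < c i)%N /\ forall v, v != j ->
    (v == j.+1) = false -> (load c v <= f v)%N.
  have [i ij ci] := sum_pos s; exists i => //; split=> // v /negPf vj vj1.
  by have := h v; rewrite /raise /edge vj vj1 addn0.
case: ci => ci hv.
have hj1 : load c j.+1 = 0%N by rewrite /load cj z.
(* The factor to drop is e_(j-1) if it occurs, as it contains x_j; otherwise the product is free of
   x_j and any factor will do. *)
have [[i0 i0j] [ci0 hi0]] : exists i0 : {i : nat | (i < j)%N}, (0 < c (sval i0))%N /\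
    (load c j <= f j + edge (sval i0) (w (sval i0)) j)%N.
  have [[j' [jE cj']]|nc] := classic (exists j', j = j'.+1 /\ (0 < c j')%N).
    have lt : (j' < j)%N by lia.
    exists (exist _ j' lt); split=> //=; have := h j.
    have := wp j' lt; rewrite /raise /edge -jE !eqxx orbT /= !muln1; lia.
  have lt : (i < j)%N.
    by rewrite ltn_neqAle -ltnS ij andbT; apply/eqP => E; rewrite E cj in ci.
  exists (exist _ i lt); split=> //=; rewrite /load cj.
  case: j nc {lt ij s z h wp wj cj hv hj1} => [//|j'] nc.
  have -> : c j' = 0%N; last by [].
  by apply/eqP; apply: contraT; rewrite -lt0n => h; case: nc; exists j'.
apply: (powers_dec (ltnW i0j : (i0 < j.+1)%N) ci0 s z) => v /=.
have [->|vj] := eqVneq v j; first exact: hi0.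
have [->|vj1] := eqVneq v j.+1; first by rewrite hj1.
by apply: leq_trans (leq_addr _ _); apply: hv => //; apply: negbTE.
Qed.

(** A factor e_1 is cancelled. If only e_0 or only e_2 occurs, dropping one copy recovers the
    missing x_1 or x_2. If both occur, one copy of each is traded for a single e_1. *)
Lemma powers_colon_mid q f : w 1%N = 1%N -> (1 < w 0%N)%N -> (1 < w 2)%N ->
  powers 3 q.+1 (raise f 1 1) <-> powers 3 q f.
Proof.
move=> w1 w0 w2; split=> [[c [s z h]]|/(powersS (isT : 1 < 3)%N)]; last by rewrite w1.
have [c1|c1] := posnP (c 1%N); last first.
  by apply: (powers_dec (isT : 1 < 3)%N c1 s z) => v; have := h v; rewrite w1.
have c3 : c 3%N = 0%N by rewrite z.
have h0 := h 0%N; have h1 := h 1%N; have h2 := h 2%N; have h3 := h 3%N.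
rewrite /load /raise /edge /= in h0 h1 h2 h3; rewrite c1 c3 in h0 h1 h2 h3.
have h4 v : load c v.+4 = 0%N by rewrite /load !z.
have s' : (c 0%N + c 2 = q.+1)%N by move: s; rewrite !big_nat_recr ?big_geq//=; lia.
have [c2|c2] := posnP (c 2%N).
  have c0 : (0 < c 0%N)%N by lia.
  apply: (powers_dec (isT : 0 < 3)%N c0 s z) => -[|[|[|[|v]]]]; rewrite ?h4//;
  rewrite /load /edge /= ?c1 ?c2 ?c3; lia.
have [c0|c0] := posnP (c 0%N).
  apply: (powers_dec (isT : 2 < 3)%N c2 s z) => -[|[|[|[|v]]]]; rewrite ?h4//;
  rewrite /load /edge /= ?c1 ?c0 ?c3; lia.
(* e_0 e_2 / (x_1 x_2) is still a multiple of e_1 *)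
have d2 : (0 < dec c 0%N 2)%N by rewrite /dec /= subn0.
exists (inc (dec (dec c 0%N) 2%N) 1%N); split.
- by rewrite sum_inc// !sum_dec// s /=; lia.
- by move=> k k3; rewrite /inc /dec z//; case: k k3 => [|[|]].
have k0 : (w 0%N <= c 0%N * w 0%N)%N by rewrite leq_pmull.
have k2 : (w 2 <= c 2 * w 2)%N by rewrite leq_pmull.
move=> v; rewrite load_inc; have := load_dec v c0; rewrite (load_dec v d2).
move: v => [|[|[|[|v]]]]; rewrite ?h4 /edge /= w1; rewrite /load /= ?c1 ?c3; lia.
Qed.

(* The ideal generated by the variables of V, the edges e_k for k >= j (taken
   with weight 1) and the q-th power of (e_0, .., e_(j-1)). *)
Definition mixed j q (V : pred nat) f : Prop := tail_path j V f \/ powers j q f.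

Lemma mono_mixed j q (V : pred nat) : mono (mixed j q V).
Proof. apply: mono_or; [exact: mono_tail_path|exact: mono_powers]. Qed.

(** Dividing e_(j+1) by x_(j+1) creates the new variable x_(j+2). The condition on [V] keeps its
    variables away from e_j. *)
Lemma mixed_colon_leaf j q (V : pred nat) f : (forall k, (k < j)%N -> (0 < w k)%N) -> w j = 1%N ->
  (forall v, V v -> (j.+2 <= v)%N) ->
  mixed j.+1 q.+1 V (raise f j 1) <-> mixed j.+1 q (predU V (pred1 j.+2)) f.
Proof.
move=> wp wj Vj.
have b v : (j.+2 <= v)%N -> raise f j 1 v = f v by move=> h; rewrite /raise /edge; lia.
have b1 : raise f j 1 j.+1 = (f j.+1).+1 by rewrite /raise /edge; lia.
rewrite /mixed powers_colon_leaf//; split=> [[[[v Vv]|[k [jk]]]|]|[[[v /= Vv h]|[k [jk h1 h2]]]|]].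
- by rewrite b ?Vj// => h; left; left; exists v; rewrite /= ?Vv.
- have [->|kj] := eqVneq k j.+1.
    by rewrite (b j.+2)// => _ h; left; left; exists j.+2; rewrite /= ?eqxx ?orbT.
  by rewrite !b; try lia; move=> h1 h2; left; right; exists k; split.
- by right.
- case/orP: Vv => [Vv|/eqP E]; first by left; left; exists v; rewrite ?b ?Vj.
  by left; right; exists j.+1; rewrite b1 b// -E.
- by left; right; exists k; split=> //; rewrite /raise; lia.
- by right.
Qed.

(** Once e_j is in the ideal, the products using e_j are redundant, and the power of the earlier
    edges remains. *)
Lemma mixed_add_leaf j q (V : pred nat) f : w j = 1%N ->
  mixed j.+1 q V f \/ (1 <= f j)%N /\ (1 <= f j.+1)%N <-> mixed j q V f.
Proof.
move=> wj; split=> [[[[h|[k [jk h1 h2]]]|[c [s z h]]]|[h1 h2]]|[[h|[k [jk h1 h2]]]|[c [s z h]]]].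
- by left; left.
- by left; right; exists k; split=> //; lia.
- have [cj|cj] := posnP (c j).
    right; exists c; split=> // [|k]; first by move: s; rewrite big_nat_recr//= cj addn0.
    by rewrite leq_eqVlt => /orP[/eqP<-|/z].
  left; right; exists j; split=> //; [have := h j; have := load_ge c (v := j) (k := j)|
    have := h j.+1; have := load_ge c (v := j.+1) (k := j)]; rewrite eqxx ?orbT wj;
    move=> /(_ isT); lia.
- by left; right; exists j.
- by left; left; left.
- have [E|kj] := eqVneq k j; first by right; rewrite -E.
  by left; left; right; exists k; split=> //; lia.
- left; right; exists c; split=> // [|k jk]; last by apply: z; lia.
  by rewrite big_nat_recr//= s z// addn0.
Qed.

End Powers.

(** * The upper bound *)

Section UpperBound.
Variables (K : fieldType) (n : nat) (w : nat -> nat).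
Hypothesis n5 : (5 <= n)%N.
Hypothesis w_pos : forall k, (k < n.-1)%N -> (0 < w k)%N.
Hypothesis w0_gt1 : (1 < w 0%N)%N.
Implicit Types (f : nat -> nat) (V : pred nat).

Let nu := ((n - 2) %/ 3)%N.
(** As n >= 5 gives nu >= 1, the subtraction does not truncate, even at q = 0, where the ideal is
    the unit ideal. *)
Let bnd q := (2 * w 0%N * q + nu - 1)%N.

Let nu_gt0 : (0 < nu)%N.
Proof. by rewrite /nu; lia. Qed.

Let bndS q : (bnd q + 2 * w 0%N = bnd q.+1)%N.
Proof. by rewrite /bnd mulnS; lia. Qed.

Lemma mixed0_reg j V r : freg K n (mixed w j 0 V) r.
Proof. by apply: regle_unit => m; right; apply: powers0. Qed.

Lemma powers1E q f :
  powers w 1 q f <-> (q * w 0%N <= f 0%N)%N /\ (q * w 0%N <= f 1%N)%N.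
Proof.
split=> [[c [s z h]]|[h0 h1]].
  move: s; rewrite big_nat1 => <-.
  by split; [apply: leq_trans (h 0%N)|apply: leq_trans (h 1%N)]; apply: load_ge.
exists (fun k => if k is 0 then q else 0%N); split; first by rewrite big_nat1.
  by case.
by move=> [|[|v]]; rewrite /load /=; lia.
Qed.

Lemma raise_far f k c v : (k.+1 < v)%N -> raise f k c v = f v.
Proof. by move=> h; rewrite /raise /edge; lia. Qed.

Lemma raise_l f k c : raise f k c k = (f k + c)%N.
Proof. by rewrite /raise /edge eqxx muln1. Qed.

Lemma raise_r f k c : raise f k c k.+1 = (f k.+1 + c)%N.
Proof. by rewrite /raise /edge eqxx orbT muln1. Qed.

(** Dividing by x_(k+1) turns e_(k+1) into the variable x_(k+2), which absorbs e_(k+2). *)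
Lemma tail_path_colon k c V f : (0 < c)%N -> (forall v, V v -> (k.+2 <= v)%N) ->
  tail_path k.+1 V (raise f k c) <-> tail_path k.+3 (predU V (pred1 k.+2)) f.
Proof.
move=> c0 Vk; split=> [[[v Vv]|[k' [kk]]]|[[v /= Vv h]|[k' [kk h1 h2]]]].
- by rewrite raise_far ?Vk// => h; left; exists v; rewrite /= ?Vv.
- have [->|N1] := eqVneq k' k.+1.
    by rewrite (@raise_far _ _ _ k.+2)// => _ h; left; exists k.+2; rewrite /= ?eqxx ?orbT.
  rewrite !raise_far; try lia; move=> h1 h2.
  have [E|N2] := eqVneq k' k.+2.
    by left; exists k.+2; rewrite /= ?eqxx ?orbT// -E.
  by right; exists k'; split=> //; lia.
- case/orP: Vv => [Vv|/eqP E]; first by left; exists v; rewrite ?raise_far ?Vk.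
  right; exists k.+1; split=> //; first by rewrite raise_r; lia.
  by rewrite raise_far// -E.
- by right; exists k'; split; rewrite ?raise_far //; lia.
Qed.

Lemma tail_path3_reg V : freg K n (tail_path 3 V) nu.
Proof.
have := @tail_path_reg K n 3 V; rewrite /nu.
by have -> : (n - 3 + 1 = n - 2)%N by lia.
Qed.

Lemma mixed1_reg q V : (forall v, V v -> (2 <= v)%N) -> freg K n (mixed w 1 q V) (bnd q).
Proof.
move=> V2; have [->|q0] := posnP q; first exact: mixed0_reg.
have c0 : (0 < q * w 0%N)%N by rewrite muln_gt0 q0; lia.
apply: (@eq_freg _ _ (fun f => tail_path 1 V f \/
    (q * w 0%N <= f 0%N)%N /\ (q * w 0%N <= f 1%N)%N)).
  by move=> f _; rewrite /mixed powers1E.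
(* The pure power e_0^q is added to the tail. The colon has regularity at most nu, and nu plus the
   degree of e_0^q is [bnd q] plus one. *)
apply: (@freg_add _ _ _ 0 _ nu); try exact: mono_tail_path; try lia.
- apply: eq_freg (@tail_path3_reg (predU V (pred1 2%N))) => f _.
  by symmetry; apply: tail_path_colon.
- by rewrite /bnd; lia.
- apply: freg_le (@tail_path_reg K n 1 V); rewrite /bnd /nu; nia.
Qed.

Lemma mixed3_reg q V : w 1%N = 1%N -> (1 < w 2 <= w 0%N)%N ->
  (forall v, V v -> (4 <= v)%N) -> freg K n (mixed w 3 q V) (bnd q).
Proof.
move=> w1 /andP[w2 w20] V4; have V3 v : V v -> (2 < v)%N by move=> /V4; lia.
elim: q => [|q IH]; first exact: mixed0_reg.
(* Splitting at e_1: the colon is the same ideal with q in place of q + 1. *)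
apply: (@freg_split _ _ _ 1 1 (bnd q)); try exact: mono_mixed; try lia.
- apply: eq_freg IH => f _.
  rewrite /mixed powers_colon_mid//; suff -> : tail_path 3 V (raise f 1 1) <->
    tail_path 3 V f by [].
  split=> [[[v Vv]|[k [k3]]]|[[v Vv h]|[k [k3 h1 h2]]]].
  + by rewrite raise_far ?V3// => h; left; exists v.
  + by rewrite !raise_far; try lia; move=> h1 h2; right; exists k.
  + by left; exists v; rewrite ?raise_far ?V3.
  + by right; exists k; split; rewrite ?raise_far//; lia.
- by rewrite -bndS; lia.
pose a := (q.+1 * w 0%N)%N; pose b := (q.+1 * w 2)%N.
pose D0 f := tail_path 3 V f \/ (1 <= f 1%N)%N /\ (1 <= f 2%N)%N.
pose D1 f := D0 f \/ (b <= f 2%N)%N /\ (b <= f 3%N)%N.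
have a0 : (0 < a)%N by rewrite muln_gt0; lia.
have b0 : (0 < b)%N by rewrite muln_gt0; lia.
have ba : (b <= a)%N by rewrite leq_mul2l; lia.
have mD0 : mono D0 by apply: mono_or; [exact: mono_tail_path|exact: mono_edge].
have mD1 : mono D1 by apply: mono_or => //; exact: mono_edge.
have bE : (bnd q.+1).+1 = (2 * a + nu)%N by rewrite /bnd /a; lia.
(* With e_1 in the ideal, products containing e_1, or both e_0 and e_2, are redundant. Only
   e_0^(q+1) and e_2^(q+1), of exponents [a] and [b], remain. *)
apply: (@eq_freg _ _ (fun f => D1 f \/ (a <= f 0%N)%N /\ (a <= f 1%N)%N)).
  move=> f _; split=> [[[[h|h]|[h2 h3]]|[h0 h1]]|[[h|[c [s z h]]]|h]].
  - by left; left.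
  - by right.
  - left; right; exists (fun k => if k == 2%N then q.+1 else 0%N); split.
    + by rewrite !big_nat_recr ?big_geq//=; lia.
    + by move=> [|[|[|k]]].
    + rewrite /b in h2 h3; move=> [|[|[|[|v]]]]; rewrite /load /=; lia.
  - left; right; exists (fun k => if k == 0%N then q.+1 else 0%N); split.
    + by rewrite !big_nat_recr ?big_geq//=; lia.
    + by move=> [|[|[|k]]].
    + rewrite /a in h0 h1; move=> [|[|[|[|v]]]]; rewrite /load /=; lia.
  - by left; left; left.
  - have s' : (c 0%N + c 1%N + c 2 = q.+1)%N by move: s; rewrite !big_nat_recr ?big_geq//=; lia.
    have h0 := h 0%N; have h1 := h 1%N; have h2 := h 2%N; have h3 := h 3%N.
    rewrite /load w1 /= in h0 h1 h2 h3.
    have [c1|c1] := posnP (c 1%N); last by left; left; right; split; lia.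
    have [c0|c0] := posnP (c 0%N).
      left; right; rewrite /b -s' c0 c1; split; lia.
    have [c2|c2] := posnP (c 2%N).
      right; rewrite /a -s' c2 c1; split; lia.
    have p0 : (w 0%N <= c 0%N * w 0%N)%N by rewrite leq_pmull.
    have p2 : (w 2 <= c 2 * w 2)%N by rewrite leq_pmull.
    by left; left; right; split; lia.
  - by left; left; right.
(* Here e_1 is disjoint from the tail. Splitting at x_2 leaves the tail from 3 with one more
   variable, x_1 in the colon and x_2 in the sum. *)
have D0reg : freg K n D0 nu.+1.
  apply: (@freg_split1 _ _ _ 2 nu) => //; first lia.
  - apply: eq_freg (@tail_path3_reg (predU V (pred1 1%N))) => f _.
    split=> [[[v /= Vv h]|[k [k3 h1 h2]]]|[[[v Vv]|[k [k3 h1 h2]]]|[h1 _]]].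
    + case/orP: Vv => [Vv|/eqP E]; first by left; left; exists v; rewrite // /raise1; lia.
      by right; rewrite /raise1 -E; split; lia.
    + by left; right; exists k; rewrite /raise1; split; lia.
    + rewrite /raise1 => h; left; exists v; rewrite /= ?Vv//.
      by have := V4 v Vv; lia.
    + by right; exists k; move: h1 h2; rewrite /raise1; split; lia.
    + by left; exists 1%N; rewrite /= ?eqxx ?orbT //; move: h1; rewrite /raise1; lia.
  apply: freg_le (leqnSn nu) _; apply: eq_freg (@tail_path3_reg (predU V (pred1 2%N))) => f _.
  split=> [[[v /= Vv h]|h]|[[[[v Vv h]|h]|[_ h]]|h]].
  - by case/orP: Vv => [Vv|/eqP E]; [left; left; left; exists v|right; rewrite -E].
  - by left; left; right.
  - by left; exists v; rewrite /= ?Vv.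
  - by right.
  - by left; exists 2%N; rewrite /= ?eqxx ?orbT.
  - by left; exists 2%N; rewrite /= ?eqxx ?orbT.
(* The colon by e_2^(q+1) contains x_1 and x_4 and leaves the path from 5; the degree is controlled
   by [b <= a]. *)
have D1reg : freg K n D1 (bnd q.+1).
  apply: (@freg_add _ _ _ 2 _ nu) => //; try lia; last first.
    by apply: freg_le D0reg; lia.
  apply: (@freg_le _ _ _ ((n - 5 + 1) %/ 3)); first by apply: leq_div2r; lia.
  apply: eq_freg (@tail_path_reg K n 5 (predU (predU V (pred1 4%N)) (pred1 1%N))) => f _.
  rewrite /D0 tail_path_colon//; split=> [[[v /= Vv h]|h]|[[[v /= Vv h]|h]|[h _]]].
  - case/orP: Vv => [Vv|/eqP E]; first by left; left; exists v.
    by right; rewrite raise_l /raise -E; split; lia.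
  - by left; right.
  - by left; exists v; rewrite /= ?Vv.
  - by right.
  - by left; exists 1%N; rewrite /= ?eqxx ?orbT //; move: h; rewrite /raise /edge; lia.
(* The colon by e_0^(q+1) contains x_2, coming from e_1, and x_2 absorbs the power of e_2. *)
apply: (@freg_add _ _ _ 0 _ nu) => //; try lia.
apply: eq_freg (@tail_path3_reg (predU V (pred1 2%N))) => f _.
have far v : (2 <= v)%N -> raise f 0 a v = f v by move=> h; rewrite raise_far.
split=> [[[v /= Vv h]|[k [k3 h1 h2]]]|[[[[v Vv]|[k [k3]]]|[_]]|[]]].
- case/orP: Vv => [Vv|/eqP E]; first (left; left; left; exists v;
    rewrite ?far//; have := V4 v Vv; lia).
  by left; right; rewrite raise_r far// -E; split; lia.
- by left; left; right; exists k; rewrite !far//; lia.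
- by rewrite far => [h|]; [left; exists v; rewrite /= ?Vv|have := V4 v Vv; lia].
- by rewrite !far; try lia; move=> h1 h2; right; exists k.
- by rewrite far// => h; left; exists 2%N; rewrite /= ?eqxx ?orbT.
- by rewrite !far// => h _; left; exists 2%N; rewrite /= ?eqxx ?orbT //; lia.
Qed.

(* The last edge e_j of the powered part has weight 1 and a leaf, so its colon
   lowers q by one and kills x_(j+2), while adding it moves it to the tail. *)
Lemma mixed_descent j0 : (0 < j0)%N ->
  (forall k, (j0 <= k < n.-1)%N -> w k = 1%N) ->
  (forall q V, (forall v, V v -> (j0.+1 <= v)%N) -> freg K n (mixed w j0 q V) (bnd q)) ->
  forall q d V, (j0 + d <= n.-1)%N -> (forall v, V v -> ((j0 + d).+1 <= v)%N) ->
  freg K n (mixed w (j0 + d) q V) (bnd q).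
Proof.
(* Outer induction on q for the colon, which keeps d; inner induction on d for the sum, which keeps
   q. *)
move=> j00 wj base; elim=> [|q IHq] d; first by move=> *; apply: mixed0_reg.
elim: d => [|d IHd] V jn Vj; first by rewrite addn0; apply: base => v /Vj; lia.
rewrite addnS in jn Vj *.
have wd : w (j0 + d) = 1%N by apply: wj; lia.
apply: (@freg_split _ _ _ (j0 + d) 1 (bnd q)); try exact: mono_mixed; try lia.
- apply: eq_freg (IHq d.+1 (predU V (pred1 (j0 + d).+2)) _ _) => [f _||v /=]; rewrite ?addnS//.
    symmetry; apply: mixed_colon_leaf => //.
    by move=> k kj; apply: w_pos; lia.
  by case/orP=> [/Vj|/eqP->]; lia.
- by rewrite -bndS; lia.
apply: eq_freg (IHd V _ _) => [f _||v /Vj]; try lia.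
by symmetry; apply: mixed_add_leaf.
Qed.

Lemma powers_reg t : w 1%N = 1%N -> (forall k, (3 <= k < n.-1)%N -> w k = 1%N) ->
  (w 2 <= w 0%N)%N -> freg K n (powers w n.-1 t) (bnd t).
Proof.
move=> w1 w3 w20.
have E f : (forall v, (n <= v)%N -> f v = 0%N) -> mixed w n.-1 t pred0 f <-> powers w n.-1 t f.
  move=> f0; split=> [[[[]//|[k [nk _ h]]]|//]|]; last by right.
  by move: h; rewrite f0//; lia.
(* The descent peels edges of weight 1 only, so it reaches j = 1 if e_2 has weight 1 and stops at j
   = 3 otherwise. *)
apply: (eq_freg E); have [w2|w2] := leqP (w 2) 1.
  have -> : n.-1 = (1 + n.-2)%N by lia.
  apply: mixed_descent => //; last by lia.
    case=> [|[|[|k]]] // h; last by apply: w3; lia.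
    by have := @w_pos 2; lia.
  exact: mixed1_reg.
have -> : n.-1 = (3 + (n.-1 - 3))%N by lia.
apply: mixed_descent => //; last by lia.
by move=> q V; apply: mixed3_reg; rewrite ?w2.
Qed.

End UpperBound.

(** * Powers of path ideals and integral closedness *)

Section PathIdeals.
Variables (K : fieldType) (n : nat) (w : nat -> nat).
Implicit Types (m u b : 'X_{1..n}).
Local Notation gens := (path_gens K n w).

Lemma mem_path_gens (g : {mpoly K[n]}) : g \in gens <->
  exists2 k, (k.+1 < n)%N & g = 'X_[mon_of n (edge k (w k))].
Proof.
have E (i j : 'I_n) : val j = (val i).+1 ->
    ('X_i * 'X_j) ^+ w i = 'X_[mon_of n (edge i (w i))] :> {mpoly K[n]}.
  move=> ji; rewrite -mpolyXD mpolyXn; congr 'X_[_]; apply/mnmP => l.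
  rewrite mulmnE mnmDE !mnmE /edge mulnC; congr (_ * _)%N.
  by rewrite -!val_eqE /= in ji *; lia.
split=> [/allpairsPdep[i [j [_]]]|[k kn ->]].
  rewrite mem_filter => /andP[/eqP ji _] ->; exists i; last exact: E.
  by rewrite -ji; apply: ltn_ord.
apply/allpairsPdep; exists (Ordinal (ltnW kn)), (Ordinal kn).
by split; [rewrite mem_enum|rewrite mem_filter mem_enum andbT|rewrite E].
Qed.

Lemma pow_gens_powers t (g : {mpoly K[n]}) : g \in pow_gens gens t ->
  exists2 u, g = 'X_[u] & powers w n.-1 t (ev u).
Proof.
elim: t g => [|t IH] g /=.
  by rewrite inE => /eqP->; exists 0%MM; rewrite ?mpolyX0//; apply: powers0.
case/allpairsP=> -[g1 g2] /= [/mem_path_gens[k kn ->] /IH[u -> pu] ->].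
exists (u + mon_of n (edge k (w k)))%MM; first by rewrite mpolyXD mulrC.
have kn' : (k < n.-1)%N by lia.
by apply: mono_powers (powersS kn' pu) => v; rewrite ev_raise.
Qed.

Lemma powers_pow_gens t m : powers w n.-1 t (ev m) -> mon_dvd (pow_gens gens t) m.
Proof.
elim: t m => [|t IH] m [c [s z h]].
  by exists 0%MM; rewrite ?mpolyX0 ?inE//; apply/mnm_lepP => i; rewrite mnm0E.
have [k kn ck] := sum_pos s; have kn1 : (k.+1 < n)%N by lia.
have le : (mon_of n (edge k (w k)) <= m)%MM.
  by apply/(edge_leP _ _ kn1); split; (apply: leq_trans (h _);
    apply: leq_trans (load_ge w c (k := k) _); rewrite ?eqxx ?orbT// leq_pmull).
case: (IH (m - mon_of n (edge k (w k)))%MM) => [|u ug um].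
  apply: (powers_dec kn ck s z) => v; apply: leq_trans (h v) _.
  rewrite evB ev_edge// subnK//; have /lem_evP/(_ v) := le; by rewrite ev_edge.
exists (u + mon_of n (edge k (w k)))%MM.
  rewrite mpolyXD mulrC; apply/allpairsP; exists ('X_[mon_of n (edge k (w k))], 'X_[u]).
  by split=> //; apply/mem_path_gens; exists k.
apply/lem_evP => v; rewrite evD.
by have /lem_evP/(_ v) := le; have /lem_evP/(_ v) := um; rewrite evB; lia.
Qed.

Lemma monomial_pow_gens t : monomial_gens (pow_gens gens t).
Proof. by move=> g /pow_gens_powers[u -> _]; exists u. Qed.

Lemma monomial_path_gens : monomial_gens gens.
Proof. by move=> g /mem_path_gens[k _ ->]; eexists. Qed.

Lemma mpolyX_inj : injective (fun u => 'X_[u] : {mpoly K[n]}).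
Proof. by move=> u v /(congr1 (@msupp n K)); rewrite !msuppX => -[]. Qed.

Lemma mon_in_pow t m : mon_in (pow_gens gens t) m <-> powers w n.-1 t (ev m).
Proof.
rewrite mon_in_dvd; last exact: monomial_pow_gens.
split=> [[u /pow_gens_powers[u' /mpolyX_inj <- pu] /lem_evP um]|]; last exact: powers_pow_gens.
exact: mono_powers pu.
Qed.

Lemma mon_in_path m : mon_in gens m <->
  exists k, [/\ (k.+1 < n)%N, (w k <= ev m k)%N & (w k <= ev m k.+1)%N].
Proof.
rewrite mon_in_dvd; last exact: monomial_path_gens.
split=> [[u /mem_path_gens[k kn /mpolyX_inj->]]|[k [kn h1 h2]]].
  by rewrite (edge_leP _ _ kn) => -[h1 h2]; exists k.
by eexists; [apply/mem_path_gens; exists k|apply/(edge_leP _ _ kn)].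
Qed.

Lemma mon_inE (gs : seq {mpoly K[n]}) m : mon_in gs m <-> in_ideal gs 'X_[m].
Proof. by rewrite /mon_in; case: excluded_middle_informative. Qed.

Lemma in_ideal0 (gs : seq {mpoly K[n]}) : in_ideal gs 0.
Proof.
exists (nseq (size gs) 0); rewrite size_nseq; split=> //.
by rewrite big1// => i _; rewrite nth_nseq if_same mul0r.
Qed.

Lemma in_idealN (gs : seq {mpoly K[n]}) f : in_ideal gs f -> in_ideal gs (- f).
Proof.
move=> [cs [sz ->]]; exists (map -%R cs); rewrite size_map; split=> //.
by rewrite -sumrN; apply: eq_bigr => i _; rewrite (nth_map 0) ?sz// mulNr.
Qed.

(** The integral equation is X^2 - f^2 = 0. *)
Lemma integral_sqr (gs : seq {mpoly K[n]}) f :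
  in_ideal (pow_gens gs 2) (f ^+ 2) -> integral_over gs f.
Proof.
move=> f2; exists 2%N, (fun i => if i == 2%N then - f ^+ 2 else 0); split=> //; split.
  by move=> [|[|[|i]]] //= _; [exact: in_ideal0|exact: in_idealN].
by rewrite big_ltn// big_nat1 /= mul0r add0r subnn expr0 mulr1 subrr.
Qed.

(* The geometric mean (rounded up) of the generators e_0 and e_j is integral
   over the ideal, and lies outside of it when both weights exceed 1. *)
Lemma integrally_closed_weights j : (forall k, (k < n.-1)%N -> (0 < w k)%N) ->
  integrally_closed gens -> (1 < w 0%N)%N -> (0 < j < n.-1)%N -> j != 2%N -> w j = 1%N.
Proof.
move=> wp ic w0 /andP[j0 jn] j2; apply/eqP; rewrite eqn_leq wp// andbT leqNgt.
apply/negP => wj.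
pose h v := (edge 0 (w 0%N) v + edge j (w j) v)%N.
pose u := mon_of n (fun v => uphalf (h v)).
have hn v : (n <= v)%N -> h v = 0%N.
  by move=> nv; rewrite /h /edge !gtn_eqF ?muln0//; lia.
have evu v : ev u v = uphalf (h v).
  by rewrite ev_mon_of; case: ltnP => // /hn->.
have /mon_inE/mon_in_path[k [kn]] : in_ideal gens 'X_[u].
  apply/ic/integral_sqr; rewrite expr2 -mpolyXD; apply/mon_inE/mon_in_pow.
  have n0 : (0 < n.-1)%N by lia.
  apply: mono_powers (powersS jn (powersS n0 (powers0 _ _ (fun=> 0%N)))) => v.
  rewrite evD !evu /raise add0n -/(h v); lia.
have hz v : v != 0%N -> v != 1%N -> v != j -> v != j.+1 -> h v = 0%N.
  by rewrite /h /edge => /negPf-> /negPf-> /negPf-> /negPf->; rewrite !muln0.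
have h0 : h 0%N = w 0%N by rewrite /h /edge /= muln1 eq_sym (gtn_eqF j0) muln0 addn0.
have hj : h j.+1 = w j.
  by rewrite /h /edge eqxx orbT muln1 eqSS (gtn_eqF j0) muln0.
have wk : (0 < w k)%N by apply: wp; lia.
rewrite !evu; have [->|k0] := eqVneq k 0%N; first by rewrite h0; lia.
have [->|kj] := eqVneq k j; first by rewrite hj; lia.
(* Every edge other than e_0 and e_j has an endpoint on neither of them; for e_1 this uses
   [j != 2]. *)
suff : h k = 0%N \/ h k.+1 = 0%N by case=> -> /=; lia.
have [E|k1] := eqVneq k 1%N; first by right; rewrite E; apply: hz; lia.
have [E|kj1] := eqVneq k j.+1; first by right; rewrite E; apply: hz; lia.
by left; apply: hz.
Qed.

End PathIdeals.

(** * The lower bound *)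

Section LowerBound.
Variables (K : fieldType) (n : nat) (w : nat -> nat).
Hypothesis n5 : (5 <= n)%N.
Hypothesis w_pos : forall k, (k < n.-1)%N -> (0 < w k)%N.
Hypothesis w3 : forall k, (3 <= k < n.-1)%N -> w k = 1%N.
Implicit Types (F H : {set 'I_n}).
Local Notation gens := (path_gens K n w).

Let nu := ((n - 2) %/ 3)%N.
Let lt_n v : (v <= 3 * nu + 1)%N -> (v < n)%N.
Proof. by rewrite /nu; lia. Qed.

(** The endpoints of the matching edges e_0, e_3, .., e_(3 nu). The multidegree [b] below is the
    exponent of the product of their generators. *)
Let good v := (v %% 3 != 2)%N && (v <= 3 * nu + 1)%N.
Let bval v : nat := if good v then (if v < 2 then w 0 else 1)%N else 0%N.
Let b := mon_of n bval.
(* The edges e_(3 k), k <= nu, form an induced matching; blk x is the k of the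
   one containing x. *)
Let blk (x : 'I_n) : 'I_nu.+1 := inord (x %/ 3).

Let blkE (x : 'I_n) : good x -> blk x = (x %/ 3)%N :> nat.
Proof. by case/andP => _ h; rewrite inordK//; lia. Qed.

Let w0_pos : (0 < w 0%N)%N.
Proof. by apply: w_pos; lia. Qed.

Let bval_pos v : (0 < bval v)%N = good v.
Proof. by rewrite /bval; case: (good v) => //; case: ifP. Qed.

Let bval_edge k : (k <= nu)%N ->
  bval (3 * k) = w (3 * k)%N /\ bval (3 * k).+1 = w (3 * k)%N.
Proof.
move=> knu; have g0 : good (3 * k) by rewrite /good; lia.
have g1 : good (3 * k).+1 by rewrite /good; lia.
rewrite /bval g0 g1; have [->|k0] := posnP k; first by rewrite muln0.
rewrite (@w3 (3 * k)); last by rewrite /nu in knu; lia.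
by split; case: ifP => //; lia.
Qed.

Let ev_msubset F v : ev (msubset b F) v =
  (bval v - [exists x in F, nat_of_ord x == v])%N.
Proof.
case: (ltnP v n) => [lt|ge]; last first.
  rewrite ev_ge// /bval; suff -> : good v = false by [].
  by rewrite /good; have := @lt_n v; lia.
rewrite -[v]/(nat_of_ord (Ordinal lt)) evE msubsetE /b mnmE; congr (_ - nat_of_bool _)%N.
apply/idP/exists_inP => [h|[x xF /eqP E]]; first by exists (Ordinal lt).
by rewrite (_ : Ordinal lt = x)//; apply: val_inj.
Qed.

(** As the matching is induced, x^(b - F) lies outside the ideal exactly when F takes an endpoint
    from every matching edge. *)
Let kvalidP F : kvalid gens b F <->
  (forall x, x \in F -> good x) /\ forall k, k \in blk @: F.
Proof.
rewrite (kvalidE _ _ (@mon_in_path K n w)) /kset; split=> -[h1 h2].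
  have gF x : x \in F -> good x by move/h1; rewrite -evE ev_mon_of ltn_ord bval_pos.
  split=> // k; apply: contraT => nk; case: h2; exists (3 * k)%N.
  have knu : (k <= nu)%N by rewrite -ltnS.
  have [E0 E1] := bval_edge knu.
  have nF v : (v %/ 3 = k)%N -> [exists x in F, nat_of_ord x == v] = false.
    move=> vk; apply/negbTE; apply: contra nk => /exists_inP[x xF /eqP xv].
    apply/imsetP; exists x => //; apply: val_inj; rewrite /= blkE ?gF// xv.
    by rewrite vk.
  split; first by apply: lt_n; lia.
    by rewrite ev_msubset nF ?subn0 ?E0//; lia.
  by rewrite ev_msubset nF ?subn0 ?E1//; lia.
split=> [x /h1|[k [kn]]]; first by rewrite -evE ev_mon_of ltn_ord bval_pos.
rewrite !ev_msubset => e0 e1.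
have wk : (0 < w k)%N by apply: w_pos; lia.
have /andP[g0 g0'] : good k by rewrite -bval_pos; lia.
have /andP[g1 g1'] : good k.+1 by rewrite -bval_pos; lia.
(* Both endpoints of e_k are matched only if 3 divides k. *)
have k3 : k = (3 * (k %/ 3))%N by lia.
have knu : (k %/ 3 < nu.+1)%N by lia.
have /imsetP[x xF xk] := h2 (Ordinal knu).
have [E0 E1] := @bval_edge (k %/ 3) knu; rewrite -k3 in E0 E1.
have : (x %/ 3 = k %/ 3)%N by rewrite -blkE ?h1// -xk.
have /andP[gx _] := h1 x xF => xk3.
have [xE|xE] : nat_of_ord x = k \/ nat_of_ord x = k.+1 by lia.
  suff : [exists x in F, nat_of_ord x == k] by move=> E; rewrite E in e0; lia.
  by apply/exists_inP; exists x; rewrite ?xE.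
suff : [exists x in F, nat_of_ord x == k.+1] by move=> E; rewrite E in e1; lia.
by apply/exists_inP; exists x; rewrite ?xE.
Qed.

Let surj_setT F : (forall k, k \in blk @: F) -> blk @: F = setT.
Proof. by move=> h; apply/setP => k; rewrite h inE. Qed.

Let cardsT_blk : #|[set: 'I_nu.+1]| = nu.+1.
Proof. by rewrite cardsT card_ord. Qed.

Let min_face F : kvalid gens b F -> (nu.+1 <= #|F|)%N.
Proof. by case/kvalidP => _ /surj_setT E; rewrite -cardsT_blk -E leq_imset_card. Qed.

Let transversal : {set 'I_n} := [set x : 'I_n | (x %% 3 == 0)%N && (x <= 3 * nu + 1)%N].

Let transversal_kvalid : kvalid gens b transversal.
Proof.
apply/kvalidP; split=> [x|k]; first by rewrite inE /good; lia.
have lt : (3 * k < n)%N by apply: lt_n; have := ltn_ord k; lia.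
apply/imsetP; exists (Ordinal lt); first by rewrite inE /=; have := ltn_ord k; lia.
by apply: val_inj; rewrite /= blkE /good /=; have := ltn_ord k; lia.
Qed.

Let card_transversal : #|transversal| = nu.+1.
Proof.
apply/eqP; rewrite eqn_leq min_face ?transversal_kvalid// andbT.
rewrite -cardsT_blk -(@card_in_imset _ _ blk); first by apply: subset_leq_card; apply: subsetT.
move=> x y; rewrite !inE => hx hy /(congr1 val) /=; rewrite !blkE /good; try lia.
by move=> E; apply: val_inj => /=; lia.
Qed.

(** By pigeonhole H contains both endpoints x and x + 1 of one matching edge. Only their removals
    give valid faces, and these carry opposite signs since the indices are consecutive. *)
Let boundary_sum H : kvalid gens b H -> #|H| = nu.+2 ->
  \sum_(j | (j \in H) && kvalid gens b (H :\ j)) sgn K (H :\ j) j = 0.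
Proof.
move=> vH cH; have /kvalidP[gH sH] := vH.
have [x [y [xH yH xy bxy]]] : exists x y, [/\ x \in H, y \in H, (x < y)%N & blk x = blk y].
  have /dinjectivePn[x xH [y]] : ~~ dinjectiveb blk H.
    apply/negP => /dinjectiveP inj; have := card_in_imset inj.
    by rewrite surj_setT// cardsT_blk cH; lia.
  rewrite inE => /andP[yx yH] E; move: yx; rewrite neq_ltn => /orP[lt|lt].
    by exists y, x.
  by exists x, y.
have remove z z' : z \in H -> z' \in H -> z != z' -> blk z = blk z' ->
    kvalid gens b (H :\ z).
  move=> zH z'H zz' bz; apply/kvalidP; split=> [l|k].
    by rewrite inE => /andP[_ /gH].
  have /imsetP[l lH ->] := sH k; have [->|lz] := eqVneq l z.
    by rewrite bz; apply: imset_f; rewrite !inE z'H eq_sym zz'.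
  by apply: imset_f; rewrite !inE lz.
have nxy : x != y by rewrite neq_ltn xy.
have vx := remove _ _ xH yH nxy bxy.
have vy : kvalid gens b (H :\ y) by apply: (remove _ x) => //; rewrite eq_sym.
(* H minus y has nu + 1 elements and meets all nu + 1 edges, hence each exactly once. Any j other
   than x and y is thus alone on its edge and cannot be removed. *)
have injy : {in H :\ y &, injective blk}.
  apply/imset_injP; have /kvalidP[_ /surj_setT->] := vy.
  by rewrite cardsT_blk; have := cH; rewrite (cardsD1 y) yH add1n => -[->].
rewrite (bigD1 x)/= ?xH// (bigD1 y)/= ?yH ?vy ?[y == x]eq_sym// big1 ?addr0.
  have y1 : nat_of_ord y = x.+1.
    have /andP[g1 _] := gH _ xH; have /andP[g2 _] := gH _ yH.
    by have := congr1 val bxy; rewrite /= !blkE ?gH//; lia.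
  rewrite /sgn (_ : [set k in H :\ y | (k < y)%N] = x |: [set k in H :\ x | (k < x)%N]).
    rewrite cardsU1 !inE eqxx /= exprS; ring.
  apply/setP => k; rewrite !inE y1 ltnS leq_eqVlt.
  have [->|kx] := eqVneq k x; first by rewrite nxy xH eqxx.
  have -> : (nat_of_ord k == x) = false by apply/negbTE.
  case: ltnP => h /=; rewrite ?andbF ?andbT//.
  suff -> : k != y by [].
  by apply/eqP => E; rewrite E y1 in h; lia.
move=> j /andP[/andP[/andP[jH vj] jx] jy]; exfalso.
have /kvalidP[_ /(_ (blk j))/imsetP[l]] := vj.
rewrite !inE => /andP[lj lH] bjl.
have jHy : j \in H :\ y by rewrite !inE jy.
have [ly|ly] := eqVneq l y.
  by case/eqP: jx; apply: (injy _ _ jHy); [rewrite !inE nxy|rewrite bjl ly bxy].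
by case/eqP: lj; apply: (injy _ _ _ jHy) => //; rewrite !inE ly.
Qed.

Let mdeg_b : (2 * w 0%N + 2 * nu <= mdeg b)%N.
Proof.
pose h v := (if (v %% 3 == 2)%N then 0 else if v < 2 then w 0 else 1)%N.
have sum_h mu : (\sum_(0 <= v < 3 * mu + 2) h v = 2 * w 0%N + 2 * mu)%N.
  elim: mu => [|mu IH]; first by rewrite !big_nat_recr ?big_geq//= /h /=; lia.
  have -> : (3 * mu.+1 + 2 = (3 * mu + 2).+3)%N by lia.
  rewrite !big_nat_recr//= IH /h.
  have -> : ((3 * mu + 2) %% 3 == 2)%N = true by lia.
  have -> : ((3 * mu + 2).+1 %% 3 == 2)%N = false by lia.
  have -> : ((3 * mu + 2).+2 %% 3 == 2)%N = false by lia.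
  have -> : ((3 * mu + 2).+1 < 2)%N = false by lia.
  have -> : ((3 * mu + 2).+2 < 2)%N = false by lia.
  by lia.
have le : (3 * nu + 2 <= n)%N by rewrite /nu; lia.
rewrite /b mdeg_mon_of (big_cat_nat (leq0n _) le) /= -sum_h.
apply: leq_trans (leq_addr _ _); rewrite eq_leq//.
apply: eq_big_nat => v /andP[_ vn]; rewrite /bval /h /good.
have -> : (v <= 3 * nu + 1)%N = true by lia.
by rewrite andbT; case: eqP.
Qed.

(** The nonzero Betti number sits in homological degree nu + 1 and in degree at least 2 (w 0) + 2
    nu. *)
Lemma path_reg_ge r : reg_le gens r -> (2 * w 0%N + nu <= r.+1)%N.
Proof.
move=> /(_ nu.+1 b) h; have := mdeg_b.
suff /h : betti gens nu.+1 b <> 0%N by lia.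
apply: betti_neq0 transversal_kvalid card_transversal min_face _.
exact: boundary_sum.
Qed.

End LowerBound.

(** * Comparison of the two bounds *)

Theorem theorem4p14 (K : fieldType) (n : nat) (w : nat -> nat) :
  (5 <= n)%N ->
  (forall i, (i < n.-1)%N -> (0 < w i)%N) ->
  (exists i, (i < n.-1)%N /\ (2 <= w i)%N) ->
  integrally_closed (path_gens K n w) ->
  (forall i, (i < n.-1)%N -> (w i <= w 0%N)%N) ->
  forall (t r : nat), (1 <= t)%N ->
    is_reg (path_gens K n w) r ->
    reg_le (pow_gens (path_gens K n w) t) (2 * (t - 1) * w 0%N + r)%N.
Proof.
move=> n5 w_pos [i [i_lt wi]] ic w_max t r t_pos [r_reg _].
have w0_gt1 : (1 < w 0%N)%N by apply: leq_trans wi (w_max i i_lt).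
have w1 : w 1%N = 1%N by apply: (integrally_closed_weights w_pos ic) => //; lia.
have w3 k : (3 <= k < n.-1)%N -> w k = 1%N.
  by move=> k3; apply: (integrally_closed_weights w_pos ic) => //; lia.
have r_ge := path_reg_ge n5 w_pos w3 r_reg.
apply: (regle_reg_le (@mon_in_pow K n w t)).
have w2 : (w 2 <= w 0%N)%N by apply: w_max; lia.
(* The upper bound 2 (w 0) t + nu - 1 equals 2 (t - 1) (w 0) plus the lower bound 2 (w 0) + nu - 1
   for r. *)
apply: regle_le (@powers_reg K n w n5 w_pos w0_gt1 t w1 w3 w2).
case: t t_pos => // t _; rewrite subn1 /= mulnS; nia.
Qed.
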